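(* Let $\mathfrak A$ be an $\aleph_0$-categorical structure with at least two elements and let $\mathfrak B$ be a structure. Then the following are equivalent: (1) $\mathfrak B$ is existentially interpretable in $\mathfrak A$; (2) there is a continuous monoid homomorphism $f:\mathrm{Emb}(\mathfrak A)\to\mathrm{End}(\mathfrak B)$ such that $B$ is covered by finitely many orbits under the image $f[\mathrm{Emb}(\mathfrak A)]$; (3) there is a continuous monoid homomorphism $f:\mathrm{Emb}(\mathfrak A)\to\mathrm{End}(\mathfrak B)$ such that $B$ is covered by finitely many orbits under $f[\mathrm{Aut}(\mathfrak A)]$.
   Context: All structures are in an at most countable signature without function symbols (relation symbols, possibly constants); $A,B$ denote the universes of $\mathfrak A,\mathfrak B$. A structure is called $\aleph_0$-categorical if it is finite or a countable model of an $\aleph_0$-categorical theory in an at most countable language. Definability is without parameters. $\mathrm{Aut}(\mathfrak M)$ is the automorphism group, $\mathrm{Emb}(\mathfrak M)$ the monoid of self-embeddings (isomorphisms of $\mathfrak M$ onto a substructure of $\mathfrak M$), and $\mathrm{End}(\mathfrak M)$ the monoid of endomorphisms (homomorphisms $\mathfrak M\to\mathfrak M$). Maps act from the right: $x^{\sigma}=\sigma(x)$, $x^{\sigma\tau}=\tau(\sigma(x))$. These monoids carry the topology of pointwise convergence, with basic open sets $U_{\bar a,\bar b}=\{\sigma\mid \bar a^\sigma=\bar b\}$ for finite tuples $\bar a,\bar b$. For a set $\Sigma$ of maps $B\to B$, the orbit of $b\in B$ under $\Sigma$ is $\{b^\sigma\mid\sigma\in\Sigma\}$. The basic sets of a structure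 are its universe, the diagonal (equality relation), the interpretations of the relation symbols, and the (graphs of the) interpretations of the constants. An interpretation of $\mathfrak B$ in $\mathfrak A$ is a surjection $i:U\to B$ with $U\subseteq A^n$ for some $n$, such that the inverse images under $i$ (taken componentwise) of all basic sets of $\mathfrak B$ are definable in $\mathfrak A$; it is existential if all these inverse images are definable in $\mathfrak A$ by existential formulas. $\mathfrak B$ is existentially interpretable in $\mathfrak A$ if such an existential interpretation exists. *)

(* Defs.v *)
From HB Require Import structures.
From mathcomp Require Import all_boot all_algebra.
From mathcomp Require Import all_classical topology.

Set Implicit Arguments.
Unset Strict Implicit.
Unset Printing Implicit Defensive.

Local Open Scope classical_set_scope.
Local Open Scope card_scope.

(* Relation symbols of arbitrary finite arity and constants, at most countably
   many of each; there are no function symbols. *)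
Record signature := Signature {
  rsym : countType;
  arity : rsym -> nat;
  csym : countType }.

(* The universe may be empty. *)
Record structure (L : signature) := Structure {
  carrier :> Type;
  rel_of : forall R : rsym L, set ('I_(arity R) -> carrier);
  cst_of : csym L -> carrier }.
Arguments rel_of {L} s R _ : rename.
Arguments cst_of {L} s c : rename.

(* [formula L n] is the type of first-order formulas with equality whose free
   variables are among x_0, ..., x_(n-1).  The quantifier in [FEx] binds the
   variable [ord0], the free variable x_i being renamed to [lift ord0 i]. *)
Inductive term (L : signature) (n : nat) : Type :=
| Var of 'I_n
| Cst of csym L.

Inductive formula (L : signature) : nat -> Type :=
| FFalse n : formula L n
| FEq n : term L n -> term L n -> formula L n
| FRel n (R : rsym L) : ('I_(arity R) -> term L n) -> formula L n
| FNot n : formula L n -> formula L n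
| FAnd n : formula L n -> formula L n -> formula L n
| FEx n : formula L n.+1 -> formula L n.

Definition extend (T : Type) (n : nat) (x : T) (v : 'I_n -> T) :
    'I_n.+1 -> T :=
  fun i => if unlift ord0 i is Some j then v j else x.

Definition eval (L : signature) (M : structure L) (n : nat) (v : 'I_n -> M)
    (t : term L n) : M :=
  match t with Var i => v i | Cst c => cst_of M c end.

Fixpoint sat (L : signature) (M : structure L) (n : nat) (phi : formula L n) :
    ('I_n -> M) -> Prop :=
  match phi with
  | FFalse _ => fun _ => False
  | FEq _ s t => fun v => eval v s = eval v t
  | FRel _ R ts => fun v => rel_of M R (fun i => eval v (ts i))
  | FNot _ p => fun v => ~ sat p v
  | FAnd _ p q => fun v => sat p v /\ sat q v
  | FEx _ p => fun v => exists x : M, sat p (extend x v)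
  end.

Fixpoint quantifier_free (L : signature) (n : nat) (phi : formula L n) : bool :=
  match phi with
  | FFalse _ | FEq _ _ _ | FRel _ _ _ => true
  | FNot _ p => quantifier_free p
  | FAnd _ p q => quantifier_free p && quantifier_free q
  | FEx _ _ => false
  end.

Fixpoint existential (L : signature) (n : nat) (phi : formula L n) : bool :=
  match phi with
  | FEx _ p => existential p
  | p => quantifier_free p
  end.

Definition existentially_definable (L : signature) (M : structure L) (n : nat)
    (X : set ('I_n -> M)) : Prop :=
  exists2 phi : formula L n, existential phi & X = [set v | sat phi v].

Definition is_hom (L : signature) (M N : structure L) (h : M -> N) : Prop :=
  (forall (R : rsym L) (v : 'I_(arity R) -> M),
     rel_of M R v -> rel_of N R (h \o v)) /\
  (forall c : csym L, h (cst_of M c) = cst_of N c).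

Definition is_embedding (L : signature) (M N : structure L) (h : M -> N) :
    Prop :=
  [/\ injective h,
      forall (R : rsym L) (v : 'I_(arity R) -> M),
        rel_of M R v <-> rel_of N R (h \o v)
    & forall c : csym L, h (cst_of M c) = cst_of N c].

Definition is_isomorphism (L : signature) (M N : structure L) (h : M -> N) :
    Prop :=
  is_embedding h /\ bijective h.

Definition isomorphic (L : signature) (M N : structure L) : Prop :=
  exists h : M -> N, is_isomorphism h.

(* A theory is a set of sentences; a sentence has a unique valuation. *)
Definition models (L : signature) (M : structure L) (T : set (formula L 0)) :
    Prop :=
  forall phi, T phi -> forall v : 'I_0 -> M, sat phi v.

Definition countably_infinite (T : Type) : Prop := [set: T] #= [set: nat].

Definition aleph0_categorical_theory (L : signature) (T : set (formula L 0)) :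
    Prop :=
  forall M N : structure L,
    countably_infinite M -> countably_infinite N ->
    models M T -> models N T -> isomorphic M N.

Definition aleph0_categorical (L : signature) (M : structure L) : Prop :=
  finite_set [set: M] \/
  (countably_infinite M /\
   exists T : set (formula L 0), models M T /\ aleph0_categorical_theory T).

Record Emb (L : signature) (M : structure L) := MkEmb {
  emb_fun :> M -> M;
  embP : is_embedding emb_fun }.

Record Endo (L : signature) (M : structure L) := MkEndo {
  endo_fun :> M -> M;
  endoP : is_hom endo_fun }.

Definition Aut (L : signature) (M : structure L) : set (Emb M) :=
  [set s : Emb M | is_isomorphism s].
Arguments Aut {L} M _.

(* The sets U_{a,b} of those elements of a set S of self-maps of M that send
   the finite tuple a to b; S is presented by its evaluation map. *)
Definition pointwise_basic (M S : Type) (ev : S -> M -> M) : set (set S) :=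
  [set U | exists n (a b : 'I_n -> M), U = [set s | forall i, ev s (a i) = b i]].

Section PointwiseBase.
Variables (M S : Type) (ev : S -> M -> M).

Lemma pointwise_cover : \bigcup_(U in pointwise_basic ev) U = setT.
Proof.
apply/seteqP; split=> // s _.
pose z : 'I_0 -> M := fun i => False_rect M (notF (ltn_ord i)).
exists [set s | forall i, ev s (z i) = z i]; last by case.
by exists 0, z, z.
Qed.

Lemma pointwise_join (U V : set S) (s : S) :
  pointwise_basic ev U -> pointwise_basic ev V -> U s -> V s ->
  exists W, [/\ pointwise_basic ev W, W s & W `<=` U `&` V].
Proof.
move=> [n [a [b ->]]] [m [c [d ->]]] /= Us Vs.
pose glue (f : 'I_n -> M) (g : 'I_m -> M) (i : 'I_(n + m)) :=
  match fintype.split i with inl j => f j | inr k => g k end.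
exists [set t | forall i, ev t (glue a c i) = glue b d i]; split.
- by exists (n + m), (glue a c), (glue b d).
- by move=> i; rewrite /glue; case: (fintype.split i).
- move=> t /= ht; split=> i.
    by have := ht (lshift m i); rewrite /glue (unsplitK (inl i)).
  by have := ht (rshift n i); rewrite /glue (unsplitK (inr i)).
Qed.

End PointwiseBase.

Section EmbMonoid.
Variables (L : signature) (M : structure L).
Implicit Types s t : Emb M.

Lemma emb_eq s t : (s : M -> M) = t -> s = t.
Proof. by case: s t => [f p] [g q] /= e; subst g; congr MkEmb. Qed.

Lemma is_embedding_id : is_embedding (@id M).
Proof. by split. Qed.

Lemma is_embedding_comp s t : is_embedding (t \o s).
Proof.
case: s t => [f [fi fr fc]] [g [gi gr gc]]; split=> /=.
- exact: inj_comp.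
- by move=> R v; rewrite fr gr.
- by move=> c; rewrite fc gc.
Qed.

Definition emb_one := MkEmb is_embedding_id.
(* Maps act from the right: the product s * t is "first s, then t". *)
Definition emb_mul s t := MkEmb (is_embedding_comp s t).

HB.instance Definition _ := gen_eqMixin (Emb M).
HB.instance Definition _ := gen_choiceMixin (Emb M).

Lemma emb_mulA : associative emb_mul.
Proof. by move=> s t u; apply: emb_eq. Qed.
Lemma emb_1mul : left_id emb_one emb_mul.
Proof. by move=> s; apply: emb_eq. Qed.
Lemma emb_mul1 : right_id emb_one emb_mul.
Proof. by move=> s; apply: emb_eq. Qed.

HB.instance Definition _ :=
  isMonoid.Build (Emb M) emb_mulA emb_1mul emb_mul1.

HB.instance Definition _ := @isBaseTopological.Build (Emb M) (set (Emb M))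
  (pointwise_basic (@emb_fun L M)) id
  (pointwise_cover _) (@pointwise_join _ _ _).

End EmbMonoid.

Section EndoMonoid.
Variables (L : signature) (M : structure L).
Implicit Types s t : Endo M.

Lemma endo_eq s t : (s : M -> M) = t -> s = t.
Proof. by case: s t => [f p] [g q] /= e; subst g; congr MkEndo. Qed.

Lemma is_hom_id : is_hom (@id M).
Proof. by split. Qed.

Lemma is_hom_comp s t : is_hom (t \o s).
Proof.
case: s t => [f [fr fc]] [g [gr gc]]; split=> /=.
- by move=> R v /fr /gr.
- by move=> c; rewrite fc gc.
Qed.

Definition endo_one := MkEndo is_hom_id.
Definition endo_mul s t := MkEndo (is_hom_comp s t).

HB.instance Definition _ := gen_eqMixin (Endo M).
HB.instance Definition _ := gen_choiceMixin (Endo M).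

Lemma endo_mulA : associative endo_mul.
Proof. by move=> s t u; apply: endo_eq. Qed.
Lemma endo_1mul : left_id endo_one endo_mul.
Proof. by move=> s; apply: endo_eq. Qed.
Lemma endo_mul1 : right_id endo_one endo_mul.
Proof. by move=> s; apply: endo_eq. Qed.

HB.instance Definition _ :=
  isMonoid.Build (Endo M) endo_mulA endo_1mul endo_mul1.

HB.instance Definition _ := @isBaseTopological.Build (Endo M) (set (Endo M))
  (pointwise_basic (@endo_fun L M)) id
  (pointwise_cover _) (@pointwise_join _ _ _).

End EndoMonoid.

Definition orbit_of (L : signature) (M : structure L) (S : set (Endo M))
    (b : M) : set M :=
  [set s b | s in S].

Definition finitely_many_orbits (L : signature) (M : structure L)
    (S : set (Endo M)) : Prop :=
  exists2 D : set M, finite_set D & \bigcup_(b in D) orbit_of S b = [set: M].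

Inductive basic_set (L : signature) (M : structure L) :
    forall k : nat, set ('I_k -> M) -> Prop :=
| basic_universe : @basic_set L M 1 setT
| basic_diagonal : @basic_set L M 2 [set v | v ord0 = v ord_max]
| basic_relation (R : rsym L) : basic_set (rel_of M R)
| basic_constant (c : csym L) : @basic_set L M 1 [set v | v ord0 = cst_of M c].

(* The componentwise inverse image of X <= B^k under i : U -> B, U <= A^n, is a
   subset of U^k, viewed inside A^(k * n) by concatenating k tuples of
   length n. *)
Definition interp_preimage (A B : Type) (n : nat) (U : set ('I_n -> A))
    (i : {x | U x} -> B) (k : nat) (X : set ('I_k -> B)) :
    set ('I_(k * n) -> A) :=
  [set w | exists2 u : 'I_k -> {x | U x},
     (forall p q, w (mxvec_index p q) = sval (u p) q) & X (i \o u)].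

Definition existential_interpretation (LA LB : signature) (A : structure LA)
    (B : structure LB) (n : nat) (U : set ('I_n -> A)) (i : {x | U x} -> B) :
    Prop :=
  (forall b : B, exists u, i u = b) /\
  (forall (k : nat) (X : set ('I_k -> B)), basic_set X ->
     existentially_definable (interp_preimage i X)).

Definition existentially_interpretable (LA LB : signature) (B : structure LB)
    (A : structure LA) : Prop :=
  exists (n : nat) (U : set ('I_n -> A)) (i : {x | U x} -> B),
    existential_interpretation i.

(* Main.v *)
(* Oligomorphy of A (finitely many automorphism orbits on n-tuples, for every n)
   comes from Ryll-Nardzewski's theorem: if there were infinitely many n-types, a
   Henkin construction whose conditions are formulas satisfied by infinitely
   many n-types would produce a countable model with a tuple of non-isolated
   type, and a second construction a countable model omitting that type; both
   models are isomorphic to A by categoricity.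

   Oligomorphy makes the space of sequences of elements of A compact modulo
   Aut(A).  This yields, first, that a subset of A^n preserved by all
   self-embeddings is existentially definable, and second, that for a continuous
   f : Emb(A) -> End(B) and b in B the value b^f(s) depends only on the
   restriction of s to a finite tuple that does not depend on s.  Sending the
   images of this tuple, for each of the finitely many orbit representatives b,
   to b^f(s) is then an existential interpretation; the equality pattern of some
   additional coordinates records which representative is meant.  Conversely,
   self-embeddings preserve existential formulas and therefore act on an
   existentially interpreted structure. *)

From HB Require Import structures.
Require Import Defs.
From mathcomp Require Import all_boot all_algebra.
From mathcomp Require Import all_classical topology.

Set Implicit Arguments.
Unset Strict Implicit.
Unset Printing Implicit Defensive.

Local Open Scope classical_set_scope.

(** * Formulas *)

Section Syntax.
Variable L : signature.

Definition term_ren n m (r : 'I_n -> 'I_m) (t : term L n) : term L m :=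
  match t with Var i => Var L (r i) | Cst c => Cst m c end.

Definition lift_ren n m (r : 'I_n -> 'I_m) (i : 'I_n.+1) : 'I_m.+1 :=
  if unlift ord0 i is Some j then lift ord0 (r j) else ord0.

Fixpoint ren n (phi : formula L n) : forall m, ('I_n -> 'I_m) -> formula L m :=
  match phi with
  | FFalse _ => fun m _ => FFalse L m
  | FEq _ s t => fun m r => FEq (term_ren r s) (term_ren r t)
  | FRel _ R ts => fun m r => FRel (fun i => term_ren r (ts i))
  | FNot _ p => fun m r => FNot (ren p r)
  | FAnd _ p q => fun m r => FAnd (ren p r) (ren q r)
  | FEx _ p => fun m r => FEx (ren p (lift_ren r))
  end.

Definition FAll n (I : finType) (F : I -> formula L n) : formula L n :=
  foldr (fun i phi => FAnd (F i) phi) (FNot (FFalse L n)) (enum I).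

(** The bound block comes first: free variable [j] of the result is variable [rshift m j] of the
    body. *)
Fixpoint exs m n : formula L (m + n) -> formula L n :=
  match m with
  | 0 => id
  | m'.+1 => fun phi => exs (FEx phi)
  end.

Lemma ren_qf n (phi : formula L n) m (r : 'I_n -> 'I_m) :
  quantifier_free (ren phi r) = quantifier_free phi.
Proof.
by elim: phi m r => //= {}n p IHp q IHq m r; rewrite IHp IHq.
Qed.

Lemma FAll_qf n (I : finType) (F : I -> formula L n) :
  (forall i, quantifier_free (F i)) -> quantifier_free (FAll F).
Proof. by move=> qF; rewrite /FAll; elim: (enum I) => //= i s ->; rewrite qF. Qed.

Lemma qf_existential n (phi : formula L n) :
  quantifier_free phi -> existential phi.
Proof. by case: phi. Qed.

Lemma exs_existential m n (phi : formula L (m + n)) :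
  existential phi -> existential (exs phi).
Proof. by elim: m phi => //= m IH phi ephi; apply: IH. Qed.

Variable M : structure L.

Lemma extend0 T n (x : T) (v : 'I_n -> T) : extend x v ord0 = x.
Proof. by rewrite /extend unlift_none. Qed.

Lemma extendS T n (x : T) (v : 'I_n -> T) j : extend x v (lift ord0 j) = v j.
Proof. by rewrite /extend liftK. Qed.

Lemma extend_lift_ren T n m (r : 'I_n -> 'I_m) (x : T) (v : 'I_m -> T) :
  extend x v \o lift_ren r = extend x (v \o r).
Proof.
apply/funext => i; rewrite /= /lift_ren /extend.
by case: (unliftP ord0 i) => [j|] _; rewrite ?liftK ?unlift_none.
Qed.

Lemma comp_extend T S n (h : T -> S) (x : T) (v : 'I_n -> T) :
  h \o extend x v = extend (h x) (h \o v).
Proof. by apply/funext => i; rewrite /= /extend; case: unlift. Qed.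

Lemma extend_eta T n (v : 'I_n.+1 -> T) :
  extend (v ord0) (v \o lift ord0) = v.
Proof.
by apply/funext => i; rewrite /extend; case: unliftP => [j|] ->.
Qed.

Lemma eval_ren n m (r : 'I_n -> 'I_m) (t : term L n) (v : 'I_m -> M) :
  Defs.eval v (term_ren r t) = Defs.eval (v \o r) t.
Proof. by case: t. Qed.

Lemma sat_ren n (phi : formula L n) m (r : 'I_n -> 'I_m) (v : 'I_m -> M) :
  sat (ren phi r) v <-> sat phi (v \o r).
Proof.
elim: phi m r v => [{}n|{}n s t|{}n R ts|{}n p IH|{}n p IHp q IHq|{}n p IH] m r v //=.
- by rewrite !eval_ren.
- by under eq_fun do rewrite eval_ren.
- by rewrite IH.
- by rewrite IHp IHq.
- by split=> -[x hx]; exists x; move: hx; rewrite IH extend_lift_ren.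
Qed.

Lemma sat_FAll n (I : finType) (F : I -> formula L n) (v : 'I_n -> M) :
  sat (FAll F) v <-> forall i, sat (F i) v.
Proof.
rewrite /FAll; transitivity (forall i, i \in enum I -> sat (F i) v).
  elim: (enum I) => [|i s IH] /=; first by split=> // _ [].
  rewrite IH; split=> [[hi hs] j|h].
    by rewrite inE => /orP[/eqP->|/hs].
  by split=> [|j js]; apply: h; rewrite inE ?eqxx ?js ?orbT.
by split=> h i => [|_]; apply: h; rewrite mem_enum.
Qed.

Lemma sat_exs m n (phi : formula L (m + n)) (v : 'I_n -> M) :
  sat (exs phi) v <->
  exists2 u : 'I_(m + n) -> M, u \o (@rshift m n) = v & sat phi u.
Proof.
elim: m phi => [|m IH] phi /=.
  have r0 : @rshift 0 n = id by apply/funext => i; apply: val_inj.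
  by rewrite r0; split=> [h|[u <-]//]; exists v.
have rS j : @rshift m.+1 n j = lift ord0 (@rshift m n j) by apply: val_inj.
rewrite IH; split=> [[u uv /= [x hx]]|[u uv hu]].
  exists (extend x u) => //; rewrite -uv; apply/funext => j /=.
  by rewrite rS -(extendS x u).
exists (u \o lift ord0); first by rewrite -uv; apply/funext => j /=; rewrite rS.
by exists (u ord0); rewrite (extend_eta u).
Qed.

End Syntax.

(** * Countability of the set of formulas *)

Section Countability.
Variable L : signature.

Definition term_code n (t : term L n) : nat + csym L :=
  match t with Var i => inl (val i) | Cst c => inr c end.

Lemma term_code_inj n : injective (@term_code n).
Proof. by move=> [i|c] [j|d] //= [] => [/val_inj ->|->]. Qed.

Definition atom_code : countType := (rsym L * seq (nat + csym L))%type.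

(** Coding makes the tasks of a generic construction enumerable. The argument function of a relation
    symbol is stored as the sequence of its values. *)
Fixpoint formula_code n (phi : formula L n) : GenTree.tree (atom_code + (nat + csym L)) :=
  match phi with
  | FFalse _ => GenTree.Node 0 [::]
  | FEq _ s t => GenTree.Node 1 [:: GenTree.Leaf (inr (term_code s));
                                    GenTree.Leaf (inr (term_code t))]
  | FRel _ R ts =>
      GenTree.Leaf (inl (R, [seq term_code (ts i) | i <- enum 'I_(arity R)]))
  | FNot _ p => GenTree.Node 2 [:: formula_code p]
  | FAnd _ p q => GenTree.Node 3 [:: formula_code p; formula_code q]
  | FEx _ p => GenTree.Node 4 [:: formula_code p]
  end.

Lemma formula_code_inj n : injective (@formula_code n).
Proof.
move=> phi; elim: phi => {n} [n|n s t|n R ts|n p IH|n p IHp q IHq|n p IH] psi.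
- by destruct psi.
- by destruct psi => //= -[/term_code_inj -> /term_code_inj ->].
- destruct psi => //= -[]; destruct 1 => e; congr FRel; apply/funext => i.
  apply: term_code_inj; move/eq_in_map: e; apply; exact: mem_enum.
- by destruct psi => //= -[/IH ->].
- by destruct psi => //= -[/IHp -> /IHq ->].
- by destruct psi => //= -[/IH ->].
Qed.

Definition formula_decode n t : option (formula L n) :=
  if pselect (exists phi : formula L n, formula_code phi = t) is left h
  then Some (projT1 (cid h)) else None.

Lemma formula_codeK n : pcancel (@formula_code n) (@formula_decode n).
Proof.
move=> phi; rewrite /formula_decode; case: pselect => [h|[]]; last by exists phi.
by congr Some; apply: formula_code_inj; rewrite (projT2 (cid h)).
Qed.

HB.instance Definition _ n :=
  Countable.copy (formula L n) (pcan_type (@formula_codeK n)).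

End Countability.

(** * Generic models *)

Lemma finite_set_range (T : Type) (D : set T) :
  finite_set D -> exists k (g : 'I_k -> T), D = range g.
Proof.
move=> /finite_setP [k /card_set_bijP [f [fD finj fsurj]]]; exists k.
have /choice [g gP] (i : 'I_k) : exists x, D x /\ f x = i.
  by have [x Dx fx] := fsurj i (ltn_ord i); exists x.
exists g; apply/seteqP; split=> [x Dx|_ [i _ <-]]; last exact: (gP i).1.
exists (Ordinal (fD x Dx)) => //; have [Dg fg] := gP (Ordinal (fD x Dx)).
by apply: finj; rewrite ?inE.
Qed.

Lemma countable_surj (T : Type) (a0 : T) :
  countable [set: T] -> exists e : nat -> T, forall x, exists i, e i = x.
Proof.
move=> /countable_injP [f finj].
have /choice [e eP] i : exists x, forall y, f y = i -> y = x.
  have [[x fx]|h] := pselect (exists x, f x = i); last first.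
    by exists a0 => y fy; case: h; exists y.
  by exists x => y fy; apply: finj; rewrite ?inE // fx.
by exists e => x; exists (f x); rewrite -(eP _ x).
Qed.

(** Step [m] changes the sequence only from position [n + m] on, and [P m] reads only positions
    below [n + m]; so the stages converge and the limit inherits every [P m]. *)
Lemma prefix_limit (T : Type) (n : nat) (P : nat -> set (nat -> T)) s0 :
  P 0 s0 ->
  (forall m s t, (forall i, i < n + m -> s i = t i) -> P m s -> P m t) ->
  (forall m s, P m s -> exists2 t, (forall i, i < n + m -> t i = s i) &
     P m.+1 t) ->
  exists s, forall m, P m s.
Proof.
move=> P0 Ploc Pext.
have /choice [next nextP] (ms : nat * (nat -> T)) : exists t, P ms.1 ms.2 ->
    (forall i, i < n + ms.1 -> t i = ms.2 i) /\ P ms.1.+1 t.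
  have [h|h] := pselect (P ms.1 ms.2); last by exists s0.
  by have [t] := Pext _ _ h; exists t.
pose st := fix st m := if m is m'.+1 then next (m', st m') else s0.
have stP m : P m (st m) by elim: m => [//|m IH]; apply: (nextP (m, st m) IH).2.
have stE m k i : i < n + m -> st (m + k) i = st m i.
  move=> im; elim: k => [|k IH]; first by rewrite addn0.
  rewrite addnS -IH; apply: (nextP (m + k, st (m + k)) (stP _)).1 => /=.
  by rewrite addnA ltn_addr.
(* Position [i] lies below [n + i.+1], so it is frozen from stage [i.+1] on. *)
exists (fun i => st i.+1 i) => m; apply: Ploc (stP m) => i im.
have [h|h] := leqP m i.+1.
  by rewrite -(subnKC h) stE.
by rewrite -(subnKC (ltnW h)) stE // addnS ltnS leq_addl.
Qed.

(** The Rasiowa-Sikorski argument: stage [k] shrinks the current set so as to meet the requirement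
    with code [k], if there is one. *)
Lemma dense_chain (X : Type) (cond : set (set X)) (T : countType)
    (Q : T -> set (set X)) (C0 : set X) :
  cond C0 ->
  (forall t C, cond C -> exists C', [/\ cond C', C' `<=` C & Q t C']) ->
  exists ch : nat -> set X,
    [/\ ch 0 = C0, forall k, cond (ch k),
        forall j k, j <= k -> ch k `<=` ch j
      & forall t, exists k, Q t (ch k)].
Proof.
move=> cC0 dense.
have /choice [next nextP] (kC : nat * {C | cond C}) : exists C' : {C | cond C},
    sval C' `<=` sval kC.2 /\
    (forall t : T, unpickle kC.1 = Some t -> Q t (sval C')).
  case: kC => k [C cC] /=; case: (unpickle k) => [t|];
    last by exists (exist _ C cC); split.
  have [C' [cC' sub QC']] := dense t _ cC.
  by exists (exist _ C' cC'); split => // _ [<-].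
pose ch := fix ch k := if k is k'.+1 then next (k', ch k') else exist _ C0 cC0.
exists (fun k => sval (ch k)); split => // [k|j k|t].
- exact: svalP.
- elim: k => [|k IH]; first by rewrite leqn0 => /eqP ->.
  rewrite leq_eqVlt => /orP[/eqP -> //|/IH]; apply: subset_trans.
  exact: (nextP (k, ch k)).1.
- by exists (pickle t).+1; apply: (nextP (pickle t, ch (pickle t))).2; rewrite /= pickleK.
Qed.

(** * Definable sets of assignments *)

Section DefinableAssignments.
Variables (L : signature) (A : structure L).

(** Natural numbers act as names for the elements of a model under construction, and an assignment
    [s] interprets them in [A]. Sets of assignments are the semantic form of forcing conditions. *)
Definition holds m (phi : formula L m) (v : 'I_m -> nat) : set (nat -> A) :=
  [set s : nat -> A | sat phi (s \o v)].

Definition definable (C : set (nat -> A)) : Prop :=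
  exists K (phi : formula L K), C = holds phi (@nat_of_ord K).

Lemma definable_holds m (phi : formula L m) v : definable (holds phi v).
Proof.
pose K := \max_i v i.
exists K.+1, (ren phi (fun i => inord (v i))); apply/seteqP.
have e s : (s \o @nat_of_ord K.+1) \o (fun i => inord (v i)) = s \o v :> ('I_m -> A).
  by apply/funext => i /=; rewrite inordK // ltnS leq_bigmax.
by split=> s; rewrite /holds /= sat_ren e.
Qed.

Lemma definableI C D : definable C -> definable D -> definable (C `&` D).
Proof.
move=> [K [phi ->]] [K' [psi ->]]; exists (maxn K K').
exists (FAnd (ren phi (widen_ord (leq_maxl K K')))
             (ren psi (widen_ord (leq_maxr K K')))).
by apply/seteqP; split=> s; rewrite /holds /= !sat_ren.
Qed.

Lemma definableC C : definable C -> definable (~` C).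
Proof. by move=> [K [phi ->]]; exists K, (FNot phi). Qed.

Lemma definable_support C : definable C -> exists K, forall s t,
  (forall i, i < K -> s i = t i) -> C s -> C t.
Proof.
move=> [K [phi ->]]; exists K => s t st; rewrite /holds /=.
suff -> : s \o @nat_of_ord K = t \o @nat_of_ord K by [].
by apply/funext => i /=; rewrite st.
Qed.

End DefinableAssignments.

(** * Henkin construction along generic chains of conditions *)

Section Henkin.
Variables (L : signature) (A : structure L).
Variables (n : nat) (big : set (set (nat -> A))).
Hypothesis big_nonempty : forall C, big C -> C !=set0.
Hypothesis bigU : forall C D, big (C `|` D) -> big C \/ big D.
Hypothesis big_proj : forall C D : set (nat -> A),
  (forall s, C s -> exists2 t, D t & forall i, i < n -> s i = t i) ->
  big C -> big D.

(** [big] is abstract because the construction is used twice: for sets realizing infinitely many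
    n-types and for nonempty sets. [bigU] lets a condition decide any formula; by [big_proj] bigness
    depends only on the values of the first [n] names, so all others are free to become
    witnesses. *)
Definition condition : set (set (nat -> A)) := [set C | big C /\ definable C].

Lemma condition_decide C D : condition C -> definable D ->
  condition (C `&` D) \/ condition (C `&` ~` D).
Proof.
move=> [bC dC] dD.
have : big ((C `&` D) `|` (C `&` ~` D)) by rewrite -setIUr setUv setIT.
by move=> /bigU [h|h]; [left|right]; split=> //; apply: definableI => //;
  apply: definableC.
Qed.

Lemma condition_witness m (p : formula L m.+1) (v : 'I_m -> nat) C :
  condition C -> exists C', [/\ condition C', C' `<=` C &
    (exists x, C' `<=` holds p (extend x v)) \/ C' `<=` ~` holds (FEx p) v].
Proof.
move=> cC; have [cC1|cC1] := condition_decide cC (definable_holds A (FEx p) v);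
  last by exists (C `&` ~` holds (FEx p) v);
    split=> [||]; [by []|by move=> s []|by right=> s []].
have [K KP] := definable_support cC1.2.
(* The name [x] is fresh: outside the support of the condition, the first [n] names and the range of
   [v]. Reassigning it to a witness disturbs none of them. *)
pose x := maxn K (maxn n (\max_i v i).+1).
exists ((C `&` holds (FEx p) v) `&` holds p (extend x v)); split.
- split; last by apply: definableI => //; [exact: cC1.2|exact: definable_holds].
  apply: big_proj cC1.1 => s Cs; have [a pa] := Cs.2.
  pose t i := if i == x then a else s i.
  have ts i : i < x -> s i = t i by rewrite /t ltn_neqAle => /andP[/negPf ->].
  exists t => [|i ilt]; last by apply: ts; rewrite /x !leq_max ilt orbT.
  split; first by apply: KP Cs => i ilt; apply: ts; rewrite /x leq_max ilt.
  rewrite /holds /= comp_extend /t eqxx; move: pa; congr (sat p (extend a _)).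
  by apply/funext => i; apply: ts; rewrite /x !leq_max ltnS leq_bigmax !orbT.
- by move=> s [[]].
- by left; exists x => s [].
Qed.

Variables (I : countType) (Q : I -> set (set (nat -> A))) (C0 : set (nat -> A)).
Hypothesis C0_cond : condition C0.
Hypothesis Q_dense : forall t C, condition C ->
  exists C', [/\ condition C', C' `<=` C & Q t C'].

(** Three kinds of tasks: deciding a formula, naming a witness of an existential formula or refuting
    it, and the extra tasks in [I]. Valuations are finite functions to keep the type countable. *)
Definition requirement : countType :=
  ({m : nat & (formula L m * {ffun 'I_m -> nat})%type} +
   {m : nat & (formula L m.+1 * {ffun 'I_m -> nat})%type} + I)%type.

Definition meets (r : requirement) : set (set (nat -> A)) :=
  match r with
  | inl (inl (existT m (phi, v))) =>
      [set C | C `<=` holds phi v \/ C `<=` ~` holds phi v]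
  | inl (inr (existT m (p, v))) =>
      [set C | (exists x, C `<=` holds p (extend x v)) \/
               C `<=` ~` holds (FEx p) v]
  | inr t => Q t
  end.

Lemma meets_dense r C : condition C ->
  exists C', [/\ condition C', C' `<=` C & meets r C'].
Proof.
move=> cC; case: r => [[[m [phi v]]|[m [p v]]]|t] /=.
- have [h|h] := condition_decide cC (definable_holds A phi v).
    by exists (C `&` holds phi v); split=> //; left=> s [].
  by exists (C `&` ~` holds phi v); split=> //; right=> s [].
- exact: condition_witness.
- exact: Q_dense.
Qed.

(** [U] consists of the sets that contain a member of the generic chain; as the chain decreases,
    finitely many of them contain a common member. *)
Lemma generic_filter : exists U : set (set (nat -> A)),
  [/\ U C0, forall C, U C -> exists2 C', condition C' & C' `<=` C,
      forall m (X : 'I_m -> set (nat -> A)) Y, (forall i, U (X i)) ->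
        (forall s, (forall i, X i s) -> Y s) -> U Y
    & forall r, exists2 C, U C & meets r C].
Proof.
have [ch [ch0 chC chS chQ]] := dense_chain C0_cond meets_dense.
exists [set C | exists k, ch k `<=` C]; split.
- by exists 0; rewrite ch0.
- by move=> C [k kC]; exists (ch k).
- move=> m X Y /choice [k kP] XY; exists (\max_i k i) => s cs; apply: XY => i.
  by apply: (kP i); apply: chS cs; apply: leq_bigmax.
- by move=> r; have [k] := chQ r; exists (ch k) => //; exists k.
Qed.

(** * The model of names given by a generic filter *)

Section Model.
Variable U : set (set (nat -> A)).
Hypothesis U_cond : forall C, U C -> exists2 C', condition C' & C' `<=` C.
Hypothesis U_cap : forall m (X : 'I_m -> set (nat -> A)) Y,
  (forall i, U (X i)) -> (forall s, (forall i, X i s) -> Y s) -> U Y.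
Hypothesis U_meets : forall r, exists2 C, U C & meets r C.

Let UT : U setT.
Proof. by apply: (@U_cap 0 (fun=> setT)) => // -[]. Qed.

Let US C D : U C -> C `<=` D -> U D.
Proof. by move=> UC CD; apply: (@U_cap 1 (fun=> C)) => // s /(_ ord0) /CD. Qed.

Let UI C D : U C -> U D -> U (C `&` D).
Proof.
move=> UC UD; apply: (@U_cap 2 (fun i => if i == ord0 then C else D)).
  by move=> i; case: ifP.
by move=> s h; split; [exact: (h ord0)|exact: (h ord_max)].
Qed.

Let U0 C D : U C -> U D -> (forall s, C s -> D s -> False) -> False.
Proof.
move=> UC UD CD; have [C' [/big_nonempty [s Cs] _] sub] := U_cond (UI UC UD).
by have [/CD] := sub s Cs.
Qed.

Let U_decide m (phi : formula L m) v : U (holds phi v) \/ U (~` holds phi v).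
Proof.
have [C UC /=] := U_meets (inl (inl (existT _ m (phi, finfun v)))).
have -> : finfun v = v :> ('I_m -> nat) by apply/funext => i; rewrite ffunE.
by case=> /(US UC); [left|right].
Qed.

Let U_witness m (p : formula L m.+1) v :
  U (holds (FEx p) v) -> exists x, U (holds p (extend x v)).
Proof.
move=> Up.
have [C UC /=] := U_meets (inl (inr (existT _ m (p, finfun v)))).
have -> : finfun v = v :> ('I_m -> nat) by apply/funext => i; rewrite ffunE.
case=> [[x Cx]|Cn]; first by exists x; apply: US Cx.
by case: (U0 UC Up) => s /Cn.
Qed.

Let same i j := U [set s : nat -> A | s i = s j].

Let same_refl i : same i i.
Proof. exact: US UT _. Qed.

Let same_sym i j : same i j -> same j i.
Proof. by move=> ij; apply: US ij _ => s /esym. Qed.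

Let same_trans i j k : same i j -> same j k -> same i k.
Proof. by move=> ij jk; apply: US (UI ij jk) _ => s [/= ->]. Qed.

Let same_ex i : exists j, `[< same i j >].
Proof. by exists i; apply/asboolP. Qed.

(** Least names represent the classes of names forced equal, so the quotient is a subtype of [nat]
    and hence countable. *)
Let rep i : nat := ex_minn (same_ex i).

Let rep_same i : same i (rep i).
Proof. by rewrite /rep; case: ex_minnP => j /asboolP. Qed.

Let rep_eq i j : same i j -> rep i = rep j.
Proof.
move=> ij; rewrite /rep; case: ex_minnP => a /asboolP ia ha.
case: ex_minnP => b /asboolP jb hb; apply/eqP; rewrite eqn_leq.
apply/andP; split; [apply: ha|apply: hb]; apply/asboolP.
  exact: same_trans jb.
by apply: same_trans ia; apply: same_sym.
Qed.

Let N := {i : nat | rep i == i}.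

Let rep_idem i : rep (rep i) == rep i.
Proof. by apply/eqP/esym/rep_eq. Qed.

Let cls i : N := exist _ (rep i) (rep_idem i).

Let clsP i j : cls i = cls j <-> same i j.
Proof.
split=> [[e]|ij]; last by apply: val_inj; apply: rep_eq.
by apply: same_trans (rep_same i) _; rewrite e; apply: same_sym.
Qed.

Let cls_val (x : N) : cls (val x) = x.
Proof. by apply: val_inj => /=; apply/eqP; case: x. Qed.

Let cst_witness c : exists x, U [set s : nat -> A | s x = cst_of A c].
Proof.
pose v (i : 'I_0) : nat := i.
have [|x Ux] := @U_witness 0 (FEq (Var L ord0) (Cst 1 c)) v.
  by apply: US UT _ => s _; exists (cst_of A c); rewrite /= extend0.
by exists x; apply: US Ux _ => s; rewrite /holds /= extend0.
Qed.

Let cst c : nat := projT1 (cid (cst_witness c)).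

Let cst_ofN c : U [set s : nat -> A | s (cst c) = cst_of A c].
Proof. exact: projT2 (cid (cst_witness c)). Qed.

Let modN : structure L := @Structure L N
  (fun R => [set w | U [set s : nat -> A | rel_of A R (s \o val \o w)]])
  (fun c => cls (cst c)).

Let term_index m (v : 'I_m -> nat) (t : term L m) : nat :=
  match t with Var i => v i | Cst c => cst c end.

Let eval_cls m (v : 'I_m -> nat) (t : term L m) :
  Defs.eval (M := modN) (cls \o v) t = cls (term_index v t).
Proof. by case: t. Qed.

Let term_indexP m (v : 'I_m -> nat) (t : term L m) :
  U [set s : nat -> A | s (term_index v t) = Defs.eval (s \o v) t].
Proof. by case: t => [i|c] /=; [exact: US UT _|exact: cst_ofN]. Qed.

(** Induction on the formula: negation uses that [U] decides every formula consistently, the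
    quantifier that every existential formula in [U] has a named witness. *)
Lemma truth m (phi : formula L m) (v : 'I_m -> nat) :
  sat (M := modN) phi (cls \o v) <-> U (holds phi v).
Proof.
elim: phi v => {m} [m|m a b|m R ts|m p IH|m p IHp q IHq|m p IH] v /=.
- by split=> // h; case: (U0 h h).
- rewrite !eval_cls clsP; have Ua := term_indexP v a; have Ub := term_indexP v b.
  split=> h; apply: US (UI (UI Ua Ub) h) _ => s [[/= ea eb]].
    by rewrite /holds /= -ea -eb.
  by rewrite /holds /= -ea -eb.
(* On one set in [U] the representatives of all the finitely many arguments take the values of the
   terms, so the atom can be read on either. *)
- have Ue : U [set s : nat -> A | forall i,
      s (rep (term_index v (ts i))) = Defs.eval (s \o v) (ts i)].
    apply: (@U_cap _ (fun i => [set s : nat -> A | s (rep (term_index v (ts i))) =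
                                        Defs.eval (s \o v) (ts i)])) => // i.
    apply: US (UI (rep_same (term_index v (ts i))) (term_indexP v (ts i))) _.
    by move=> s [/= <-].
  have -> : (fun i => Defs.eval (M := modN) (cls \o v) (ts i)) =
            (fun i => cls (term_index v (ts i))).
    by apply/funext => i; rewrite eval_cls.
  split=> h; apply: US (UI Ue h) _ => s [/= e]; rewrite /holds /=.
    by congr (rel_of A R _); apply/funext => i; rewrite /= e.
  by congr (rel_of A R _); apply/funext => i; rewrite /= e.
- rewrite IH; split=> [h|h h']; first by case: (U_decide p v).
  by apply: U0 h h' _ => s.
- rewrite IHp IHq; split=> [[hp hq]|h]; first exact: US (UI hp hq) _.
  by split; apply: US h _ => s [].
- split=> [[x]|/U_witness [x Ux]].
    rewrite -(cls_val x) -comp_extend IH => h; apply: US h _ => s.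
    by rewrite /holds /= comp_extend => h; exists (s (val x)).
  by exists (cls x); rewrite -comp_extend IH.
Qed.

Lemma generic_model_ex : exists (N : structure L) (pi : nat -> N),
  [/\ countable [set: N], forall x, exists i, pi i = x
    & forall m (phi : formula L m) v,
        sat phi (pi \o v) <-> U (holds phi v)].
Proof.
exists modN, cls; split=> [|x|]; [exact: countableP| |exact: truth].
by exists (val x).
Qed.

End Model.

Hypothesis A_infinite : infinite_set [set: A].

Theorem generic_model : exists (N : structure L) (pi : nat -> N) U,
  [/\ countably_infinite N, forall x, exists i, pi i = x, U C0
    & [/\ forall C D, U C -> U D -> exists2 C', condition C' & C' `<=` C `&` D,
        forall t, exists2 C, U C & Q t C
      & forall m (phi : formula L m) v,
        sat phi (pi \o v) <-> U (holds phi v)]].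
Proof.
have [U [UC0 U_cond U_cap U_meets]] := generic_filter.
have [N [pi [Nc pi_surj tr]]] := generic_model_ex U_cond U_cap U_meets.
exists N, pi, U; split=> //; last first.
  split=> // [C D UC UD|t]; last exact: (U_meets (inr t)).
  apply: U_cond; apply: (U_cap 2 (fun i => if i == ord0 then C else D)).
    by move=> i; case: ifP.
  by move=> s h; split; [exact: (h ord0)|exact: (h ord_max)].
apply: eq_card_nat => // Nfin.
have [k [g gP]] := finite_set_range Nfin.
have /choice [y yP] i := pi_surj (g i).
(* A finite enumeration of [N] is refuted by the formula stating that some element differs from [k]
   given ones: it holds under every assignment because [A] is infinite. *)
pose phi : formula L k.+1 :=
  FAll (fun j : 'I_k => FNot (FEq (Var L ord0) (Var L (lift ord0 j)))).
have /tr [x] : U (holds (FEx phi) y).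
  apply: (U_cap 0 (fun=> setT)) => [[]//|s _].
  have [a aP] : exists a, forall j, a <> s (y j).
    apply: contrapT => /forallNP h; apply: A_infinite.
    apply: (@sub_finite_set _ _ (range (s \o y))); last exact: finite_image.
    by move=> a _; have /existsNP [j /contrapT ->] := h a; exists j.
  exists a; apply/sat_FAll => j /=; rewrite extend0 extendS; exact: aP.
move=> /sat_FAll h; have [j _ gj] : range g x by rewrite -gP.
by have := h j; rewrite /= extend0 extendS /= yP gj.
Qed.

End Henkin.

(** * Types and oligomorphy *)

Lemma bij_of_surj (T S : Type) (h : T -> S) :
  injective h -> (forall y, exists x, h x = y) -> bijective h.
Proof.
move=> hi /choice [g gP]; exists g => // x; exact/hi/gP.
Qed.

Lemma sat_isomorphism (L : signature) (M N : structure L) (h : M -> N) m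
    (phi : formula L m) (v : 'I_m -> M) :
  is_isomorphism h -> sat phi v <-> sat phi (h \o v).
Proof.
move=> [[hi hr hc] [g gK hK]].
have hev k (w : 'I_k -> M) t : Defs.eval (h \o w) t = h (Defs.eval w t).
  by case: t => //= c; rewrite hc.
elim: phi v => {m} [m|m a b|m R ts|m p IH|m p IHp q IHq|m p IH] v //=.
- by rewrite !hev; split=> [->|/hi].
- by rewrite hr; under [X in _ <-> rel_of _ _ X]eq_fun do rewrite hev.
- by rewrite IH.
- by rewrite IHp IHq.
- split=> [[x]|[y]].
    by rewrite IH comp_extend; exists (h x).
  by exists (g y); rewrite IH comp_extend hK.
Qed.

(** Equalities between entries make [a i] to [b i] a well-defined injection; the other atomic
    formulas make it an embedding. *)
Lemma embedding_of_enumerations (L : signature) (A : structure L) (a b : nat -> A) :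
  (forall x, exists i, a i = x) ->
  (forall m (phi : formula L m) v, quantifier_free phi ->
     sat phi (a \o v) <-> sat phi (b \o v)) ->
  exists h : Emb A, forall i, h (a i) = b i.
Proof.
move=> /choice [idx idxP] abv.
have ab_eq i j : a i = a j <-> b i = b j.
  exact: (abv 2 (FEq (Var L ord0) (Var L ord_max)) (fun k => if k == ord0 then i else j)).
pose h x := b (idx x).
have h_emb : is_embedding h.
  split=> [x y /ab_eq|R v|c]; first by rewrite !idxP.
    have := abv _ (FRel (fun i : 'I_(arity R) => Var L i)) (idx \o v) isT.
    by rewrite /=; under eq_fun do rewrite idxP.
  have := abv 1 (FEq (Var L ord0) (Cst 1 c)) (fun=> idx (cst_of A c)) isT.
  by rewrite /= idxP => -[/(_ erefl)].
by exists (MkEmb h_emb) => i; apply/ab_eq; rewrite idxP.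
Qed.

Section Types.
Variables (L : signature) (A : structure L).

Definition same_type m (s t : nat -> A) : Prop :=
  forall phi : formula L m,
    sat phi (s \o @nat_of_ord m) <-> sat phi (t \o @nat_of_ord m).

Lemma same_type_sym m s t : same_type m s t -> same_type m t s.
Proof. by move=> st phi; rewrite st. Qed.

Lemma same_type_trans m s t u :
  same_type m s t -> same_type m t u -> same_type m s u.
Proof. by move=> st tu phi; rewrite st tu. Qed.

Lemma same_type_prefix m s t : (forall i, i < m -> s i = t i) -> same_type m s t.
Proof.
move=> st phi; suff -> : s \o @nat_of_ord m = t \o @nat_of_ord m by [].
by apply/funext => i /=; rewrite st.
Qed.

Lemma same_typeN m s t : ~ same_type m s t -> exists2 phi : formula L m,
  sat phi (s \o @nat_of_ord m) & ~ sat phi (t \o @nat_of_ord m).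
Proof.
move=> /existsNP [phi]; have [hs ht|hs ht] := pselect (sat phi (s \o @nat_of_ord m)).
  by exists phi => // ht'; apply: ht.
exists (FNot phi) => //= h; apply: ht; split=> // ht; case: h => // ht'.
Qed.

(** The representatives need not lie in [X], so the notion passes to subsets. *)
Definition finitely_many_types m (X : set (nat -> A)) : Prop :=
  exists (I : finType) (r : I -> nat -> A),
    forall s, X s -> exists k, same_type m s (r k).

Lemma finitely_many_typesU m X Y : finitely_many_types m X ->
  finitely_many_types m Y -> finitely_many_types m (X `|` Y).
Proof.
move=> [I [r rP]] [J [q qP]]; exists (I + J)%type.
exists (fun k => match k with inl i => r i | inr j => q j end).
by move=> s [/rP|/qP] [k kP]; [exists (inl k)|exists (inr k)].
Qed.

Lemma definableT : definable (@setT (nat -> A)).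
Proof.
exists 0, (FNot (FFalse L 0)); apply/seteqP; split=> [s _ []|//].
Qed.

(** [psi] quantifies over the values of all names below a bound and ties the name [v j] to the free
    variable [j]. *)
Lemma definable_image C m (v : 'I_m -> nat) : definable C ->
  exists psi : formula L m, forall w,
    sat psi w <-> exists2 s : nat -> A, C s & s \o v = w.
Proof.
move=> [K [phi ->]].
pose K' := maxn K (\max_i v i).
have Kle : K <= K'.+1 by rewrite leqW // leq_maxl.
have vK i : v i < K'.+1 by rewrite ltnS leq_max leq_bigmax orbT.
pose u0 : formula L (K'.+1 + m) := FAnd
  (ren phi (fun i => lshift m (widen_ord Kle i)))
  (FAll (fun j => FEq (Var L (lshift m (Ordinal (vK j)))) (Var L (rshift K'.+1 j)))).
exists (exs u0) => w; rewrite sat_exs; split.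
  move=> [u <- /= [up /sat_FAll /= ueq]].
  exists (fun i => u (lshift m (inord i))).
    move/sat_ren: up; congr (sat phi _); apply/funext => i /=; congr (u (lshift m _)).
    by apply: val_inj; rewrite /= inordK // (leq_trans (ltn_ord i)).
  apply/funext => j /=; rewrite -ueq; congr (u (lshift m _)).
  by apply: val_inj; rewrite /= inordK.
move=> [s sp <-].
pose u (i : 'I_(K'.+1 + m)) := match fintype.split i with
  inl j => s j | inr j => s (v j) end.
have ul j : u (lshift m j) = s j by rewrite /u (unsplitK (inl j)).
have ur j : u (rshift K'.+1 j) = s (v j) by rewrite /u (unsplitK (inr j)).
exists u; first by apply/funext => j /=.
split; last by apply/sat_FAll => j /=; rewrite ul ur.
apply/sat_ren; move: sp; congr (sat phi _); apply/funext => i /=.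
by rewrite ul.
Qed.

Lemma same_type_definable s t : (forall m, same_type m s t) ->
  forall C, definable C -> C s <-> C t.
Proof. by move=> st C [K [phi ->]]; apply: st. Qed.

Definition oligomorphic : Prop := forall m, exists (I : finType) (r : I -> nat -> A),
  forall s, exists k, exists2 a : Emb A, Aut A a & forall i, i < m -> s i = a (r k i).

Section Homogeneity.
Hypothesis types_finite : forall m, finitely_many_types m setT.

Definition update (s : nat -> A) m a : nat -> A :=
  fun i => if i == m then a else s i.

(** A finite conjunction excluding each representative of another type isolates the type of the
    extended sequence; [t] satisfies its existential closure because [s] does. *)
Lemma same_type_extend m s t a : same_type m s t ->
  exists b, same_type m.+1 (update s m a) (update t m b).
Proof.
move=> st; have [I [r rP]] := types_finite m.+1.
set s' := update s m a.
have /choice [psi psiP] k : exists psi : formula L m.+1,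
    sat psi (s' \o @nat_of_ord _) /\
    (~ same_type m.+1 s' (r k) -> ~ sat psi (r k \o @nat_of_ord _)).
  have [h|/same_typeN [psi]] := pselect (same_type m.+1 s' (r k)).
    by exists (FNot (FFalse L _)); split.
  by exists psi.
(* The quantifier binds variable [ord0], while the new element sits at the last position [m]. *)
pose rho (i : 'I_m.+1) : 'I_m.+1 :=
  if unlift ord_max i is Some j then lift ord0 j else ord0.
have rhoE c u : extend c (u \o @nat_of_ord m) \o rho =
    update u m c \o @nat_of_ord m.+1.
  apply/funext => i; rewrite /= /rho /update.
  case: unliftP => [j|] ->; last by rewrite extend0 eqxx.
  by rewrite extendS lift_max ltn_eqF.
have : sat (FEx (ren (FAll psi) rho)) (s \o @nat_of_ord m).
  by exists a; apply/sat_ren; rewrite rhoE; apply/sat_FAll => k; case: (psiP k).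
rewrite st => -[b /sat_ren]; rewrite rhoE => /sat_FAll h; exists b.
have [k tk] := rP (update t m b) Logic.I.
have [sk|/((psiP k).2) []] := pselect (same_type m.+1 s' (r k)).
  exact: same_type_trans sk (same_type_sym tk).
by apply/tk.
Qed.

Variable e : nat -> A.
Hypothesis e_surj : forall x, exists i, e i = x.

Lemma same_type_enumerations n s t : same_type n s t ->
  exists a b : nat -> A, [/\ forall m, same_type m a b,
    forall i, i < n -> a i = s i, forall i, i < n -> b i = t i,
    forall x, exists i, a i = x & forall x, exists i, b i = x].
Proof.
move=> st.
(* Back and forth: position [n + j] puts [e j./2] into the first sequence for even [j] and into the
   second for odd [j], so both exhaust [A]. *)
pose P m : set (nat -> A * A) := [set u |
  [/\ same_type (n + m) (fst \o u) (snd \o u), forall i, i < n -> u i = (s i, t i)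
    & forall j, j < m -> (if odd j then (u (n + j)).2 else (u (n + j)).1) = e j./2]].
have [|||u uP] := @prefix_limit _ n P (fun i => (s i, t i)).
- by split=> //; rewrite addn0.
- move=> m u w uw [h1 h2 h3]; split.
  + apply: same_type_trans (same_type_trans h1 _); apply: same_type_prefix => i im;
      by rewrite /= uw.
  + by move=> i lin; rewrite -uw ?h2 // ltn_addr.
  + by move=> j jm; rewrite -uw ?h3 // ltn_add2l.
- move=> m u [h1 h2 h3].
  have [[a b] /= [abP abE]] : exists ab : A * A,
      same_type (n + m).+1 (update (fst \o u) (n + m) ab.1)
                           (update (snd \o u) (n + m) ab.2) /\
      (if odd m then ab.2 else ab.1) = e m./2.
    case: (odd m).
      have [a aP] := same_type_extend (e m./2) (same_type_sym h1).
      by exists (a, e m./2); split=> //; apply: same_type_sym.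
    have [b bP] := same_type_extend (e m./2) h1.
    by exists (e m./2, b).
  exists (fun i => if i == n + m then (a, b) else u i) => [i im|].
    by rewrite ltn_eqF.
  split.
  + rewrite addnS; move: abP; rewrite /update; congr (same_type _ _ _);
      by apply/funext => i /=; case: ifP.
  + by move=> i lin; rewrite ltn_eqF ?h2 // ltn_addr.
  + move=> j; rewrite ltnS leq_eqVlt => /orP[/eqP ->|jm]; first by rewrite eqxx.
    by rewrite ltn_eqF ?h3 // ltn_add2l.
exists (fst \o u), (snd \o u); split.
- move=> m phi; have [h _ _] := uP m.
  have := h (ren phi (fun i => widen_ord (leq_addl n m) i)).
  by rewrite !sat_ren.
- by move=> i lin; have [_ h _] := uP 0; rewrite /= h.
- by move=> i lin; have [_ h _] := uP 0; rewrite /= h.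
- move=> x; have [i <-] := e_surj x; exists (n + i.*2).
  have [_ _ /(_ i.*2)] := uP i.*2.+1.
  by rewrite odd_double doubleK; apply.
- move=> x; have [i <-] := e_surj x; exists (n + i.*2.+1).
  have [_ _ /(_ i.*2.+1)] := uP i.*2.+2.
  by rewrite /= odd_double uphalf_double; apply.
Qed.

Lemma homogeneous n s t : same_type n s t ->
  exists2 a : Emb A, Aut A a & forall i, i < n -> t i = a (s i).
Proof.
move=> /same_type_enumerations [a [b [ab as_ bt asurj bsurj]]].
have [h hE] : exists h : Emb A, forall i, h (a i) = b i.
  apply: embedding_of_enumerations => // m phi v _.
  exact: (same_type_definable ab (definable_holds A phi v)).
exists h; last by move=> i lin /=; rewrite -as_ // hE bt.
split; [exact: embP|apply: bij_of_surj => [|y]]; first by case: (embP h).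
by have [i <-] := bsurj y; exists (a i).
Qed.

End Homogeneity.

(** * Ryll-Nardzewski: categoricity leaves finitely many n-types *)

Section RyllNardzewski.
Hypothesis A_inf : countably_infinite A.
Variable T : set (formula L 0).
Hypothesis A_T : models A T.
Hypothesis T_cat : aleph0_categorical_theory T.

Let A_infinite : infinite_set [set: A].
Proof. by rewrite (eq_finite_set A_inf); exact: infinite_nat. Qed.

(** Sentences of [T] hold under every assignment, so they are true in [N]; categoricity then carries
    the generic sequence into [A]. *)
Let generic_iso (N : structure L) (pi : nat -> N) (U : set (set (nat -> A))) :
  countably_infinite N -> (forall C : set (nat -> A), (forall s, C s) -> U C) ->
  (forall m (phi : formula L m) v, sat phi (pi \o v) <-> U (holds phi v)) ->
  exists2 h : N -> A, (forall y, exists x, h x = y) &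
    forall m (phi : formula L m) v, sat phi (h \o pi \o v) <-> U (holds phi v).
Proof.
move=> N_inf UT tr.
have N_T : models N T.
  move=> phi Tphi v; pose w (i : 'I_0) : nat := i.
  have -> : v = pi \o w by apply/funext => -[].
  by apply/tr/UT => s; apply: A_T.
have [h h_iso] := T_cat N_inf A_inf N_T A_T.
exists h => [y|m phi v]; first by case: h_iso => _ [g _ gK]; exists (g y).
by rewrite -tr (sat_isomorphism _ _ h_iso).
Qed.

(** Conditions realize infinitely many n-types. The set defined by a formula true of the generic
    tuple contains such a condition, so the formula isolates no type. *)
Lemma nonisolated_type n : ~ finitely_many_types n setT ->
  exists c : nat -> A, forall phi : formula L n, sat phi (c \o @nat_of_ord n) ->
    exists2 d : nat -> A, sat phi (d \o @nat_of_ord n) & ~ same_type n c d.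
Proof.
move=> nT; pose big : set (set (nat -> A)) := [set C | ~ finitely_many_types n C].
have big_ne C : big C -> C !=set0.
  move=> bC; apply/set0P/eqP => C0; apply: bC.
  exists void, (fun k : void => match k with end).
  by rewrite C0.
have bigU C D : big (C `|` D) -> big C \/ big D.
  move=> bCD; apply: contrapT => /not_orP [/contrapT hC /contrapT hD].
  by apply: bCD; apply: finitely_many_typesU.
have big_proj (C D : set (nat -> A)) :
    (forall s, C s -> exists2 t, D t & forall i, i < n -> s i = t i) ->
    big C -> big D.
  move=> CD bC [I [r rP]]; apply: bC; exists I, r => s /CD [t /rP [k tk] st].
  by exists k; apply: same_type_trans tk; apply: same_type_prefix.
have C0 : condition big setT by split=> //; exact: definableT.
have [//|N [pi [U [N_inf _ UT [U_cond _ tr]]]]] :=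
  generic_model big_ne bigU big_proj (I := void) (Q := fun=> setT) C0 _ A_infinite.
have [|h _ hP] := generic_iso N_inf _ tr.
  by move=> C CT; have -> : C = setT by apply/seteqP; split.
exists (h \o pi) => phi /hP Uphi;
have [C [bC _] CS] := U_cond _ _ Uphi Uphi; have {CS} Cphi s Cs := (CS s Cs).1.
apply: contrapT => nd.
apply: bC; exists unit, (fun=> h \o pi) => s /Cphi sphi; exists tt.
by apply: contrapT => ns; apply: nd; exists s => // /same_type_sym.
Qed.

(** The requirement indexed by [v] keeps the tuple named by [v] from realizing the type of [c]. The
    generic model thus omits this type, yet it is isomorphic to [A], where [c] realizes it. *)
Lemma omit_nonisolated n (c : nat -> A) :
  ~ (forall phi : formula L n, sat phi (c \o @nat_of_ord n) ->
    exists2 d : nat -> A, sat phi (d \o @nat_of_ord n) & ~ same_type n c d).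
Proof.
move=> noniso; pose big : set (set (nat -> A)) := [set C | C !=set0].
have bigU C D : big (C `|` D) -> big C \/ big D.
  by move=> [s [Cs|Ds]]; [left|right]; exists s.
have big_proj (C D : set (nat -> A)) :
    (forall s, C s -> exists2 t, D t & forall i, i < 0 -> s i = t i) ->
    big C -> big D.
  by move=> CD [s /CD [t Dt _]]; exists t.
have C0 : condition big setT by split; [exists c|exact: definableT].
pose Q (v : {ffun 'I_n -> nat}) : set (set (nat -> A)) := [set C |
  exists2 phi : formula L n, sat phi (c \o @nat_of_ord n) & C `<=` ~` holds phi v].
have [|N [pi [U [N_inf pi_surj UT [U_cond U_Q tr]]]]] :=
  generic_model (fun C h => h) bigU big_proj (Q := Q) C0 _ A_infinite.
  move=> v C [[s0 Cs0] dC]; apply: contrapT => nQ.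
  (* If [C] cannot be refined, it forces every formula of the type of [c] on [v]; then the formula
     defining the image of [C] under [v] isolates that type. *)
  have Cp (phi : formula L n) : sat phi (c \o @nat_of_ord n) -> C `<=` holds phi v.
    move=> cphi s Cs; apply: contrapT => ns; apply: nQ.
    exists (C `&` ~` holds phi v); split=> [|t []//|]; last by exists phi => // t [].
    split; first by exists s.
    by apply: definableI => //; apply/definableC/definable_holds.
  have [psi psiP] := definable_image v dC.
  have cpsi : sat psi (c \o @nat_of_ord n).
    apply: contrapT => npsi; have /(_ s0 Cs0) := Cp (FNot psi) npsi.
    by apply; apply/psiP; exists s0.
  have [d /psiP [s Cs sd] /same_typeN [phi cphi dphi]] := noniso _ cpsi.
  by apply: dphi; rewrite -sd; apply: Cp.
have [|h h_surj hP] := generic_iso N_inf _ tr.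
  by move=> C CT; have -> : C = setT by apply/seteqP; split.
have /choice [v vP] (i : 'I_n) : exists j, h (pi j) = c i.
  have [x <-] := h_surj (c i); have [j <-] := pi_surj x; by exists j.
have [C UC [phi cphi Cphi]] := U_Q (finfun v).
have Uphi : U (holds phi v).
  by apply/hP; have -> : h \o pi \o v = c \o @nat_of_ord n by apply/funext.
have [C' [[s C's] _] C'S] := U_cond _ _ UC Uphi.
have [/Cphi ns sphi] := C'S s C's; apply: ns; move: sphi.
by congr (holds phi _ s); apply/funext => i; rewrite ffunE.
Qed.

Lemma categorical_finitely_many_types n : finitely_many_types n setT.
Proof.
by apply: contrapT => /nonisolated_type [c /omit_nonisolated].
Qed.

End RyllNardzewski.

Lemma aleph0_categorical_countable : aleph0_categorical A -> countable [set: A].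
Proof.
case=> [/finite_set_countable//|[A_inf _]].
by rewrite (eq_countable A_inf); apply: countableP.
Qed.

(** For finite [A] all m-tuples serve as representatives, padded by [a0], with the identity as
    automorphism; for infinite [A] homogeneity turns types into orbits. *)
Lemma aleph0_categorical_oligomorphic (a0 : A) :
  aleph0_categorical A -> oligomorphic.
Proof.
move=> A_cat m; have [e e_surj] := countable_surj a0 (aleph0_categorical_countable A_cat).
case: A_cat => [/finite_set_range [k [g gP]]|[A_inf [T [A_T T_cat]]]].
  exists {ffun 'I_m -> 'I_k}.
  exists (fun (f : {ffun 'I_m -> 'I_k}) i =>
    if insub i is Some j then g (f j) else a0) => s.
  have /choice [f fP] (i : 'I_m) : exists j, g j = s i.
    have [j _ <-] : range g (s i) by rewrite -gP.
    by exists j.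
  exists (finfun f), (emb_one A).
    by split; [exact: is_embedding_id|exists id].
  by move=> i im /=; rewrite insubT ffunE fP.
have types_fin := categorical_finitely_many_types A_inf A_T T_cat.
have [I [r rP]] := types_fin m; exists I, r => s; have [k sk] := rP s Logic.I.
exists k; exact: (homogeneous types_fin e_surj (same_type_sym sk)).
Qed.

End Types.

(** * Compactness modulo automorphisms *)

Lemma infinitely_repeated_value (I : finType) (col : nat -> I) :
  exists c, forall k, exists2 k', k <= k' & col k' = c.
Proof.
apply: contrapT => /forallNP h.
have /choice [b bP] c : exists k, forall k', k <= k' -> col k' <> c.
  have /existsNP [k kP] := h c; exists k => k' kk' e; apply: kP.
  by exists k'.
by apply: (bP (col (\max_c b c)) (\max_c b c)) => //; apply: leq_bigmax.
Qed.

(** * Self-embeddings and the formulas they preserve *)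

Section Preservation.
Variables (L : signature) (M : structure L).

Lemma sat_embedding_qf (h : Emb M) m (phi : formula L m) (v : 'I_m -> M) :
  quantifier_free phi -> sat phi v <-> sat phi (h \o v).
Proof.
have [hi hr hc] := embP h.
have hev k (w : 'I_k -> M) t : Defs.eval (h \o w) t = h (Defs.eval w t).
  by case: t => //= c; rewrite hc.
elim: phi v => {m} [m|m a b|m R ts|m p IH|m p IHp q IHq|m p IH] v //=.
- by rewrite !hev; split=> [->|/hi].
- by rewrite hr; under [X in _ <-> rel_of _ _ X]eq_fun do rewrite hev.
- by move=> /IH ->.
- by move=> /andP[/IHp -> /IHq ->].
Qed.

Lemma sat_embedding_existential (h : Emb M) m (phi : formula L m) (v : 'I_m -> M) :
  existential phi -> sat phi v -> sat phi (h \o v).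
Proof.
elim: phi v => {m} [m|m a b|m R ts|m p IH|m p IHp q IHq|m p IH] v ephi;
  try by rewrite -sat_embedding_qf.
by move=> [x px]; exists (h x); rewrite -comp_extend; apply: IH.
Qed.

Lemma Aut_inverse (a : Emb M) : Aut M a ->
  exists2 b : Emb M, Aut M b & cancel a b /\ cancel b a.
Proof.
move=> [[ai ar ac] [g gK aK]].
have g_emb : is_embedding g.
  split=> [|R v|c]; first exact: can_inj aK.
    by rewrite (ar R (g \o v)) (_ : a \o (g \o v) = v) //; apply/funext => i /=.
  by rewrite -ac gK.
by exists (MkEmb g_emb) => //; split=> //; exists a.
Qed.

Lemma Aut_mul (a b : Emb M) : Aut M a -> Aut M b -> Aut M (emb_mul a b).
Proof. by move=> [_ ba] [_ bb]; split; [exact: embP|exact: bij_comp]. Qed.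

Lemma Aut_one : Aut M (emb_one M).
Proof. by split; [exact: embP|exists id]. Qed.

End Preservation.

Section Oligomorphic.
Variables (L : signature) (A : structure L) (e : nat -> A).
Hypothesis A_olig : oligomorphic A.
Hypothesis e_surj : forall x, exists i, e i = x.

(** A König argument in which oligomorphy replaces finite branching: prefixes of a given length fall
    into finitely many orbits. *)
Lemma oligomorphic_compact (F : nat -> set (nat -> A)) :
  (forall m s t, (forall i, i < m -> s i = t i) -> F m s -> F m t) ->
  (forall m s, F m.+1 s -> F m s) ->
  (forall m s (a : Emb A), Aut A a -> F m s -> F m (a \o s)) ->
  (forall m, F m !=set0) -> exists s, forall m, F m s.
Proof.
move=> Floc Fdec Faut Fne.
have Fle m k s : m <= k -> F k s -> F m s.
  by move=> mk; rewrite -(subnKC mk); elim: (k - m) => [|j IH];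
    rewrite ?addn0 ?addnS // => /Fdec.
(* The prefix of length [m] is kept extendable to members of every [F k]. *)
pose P m : set (nat -> A) :=
  [set s | forall k, exists2 t, F k t & forall i, i < m -> t i = s i].
have [|||s sP] := @prefix_limit _ 0 P e.
- by move=> k; have [t Ft] := Fne k; exists t.
- by move=> m s t st Ps k; have [u Fu us] := Ps k; exists u => // i im; rewrite us ?st.
- move=> m s Ps; have [I [r rP]] := A_olig m.+1.
  have /choice [tc tcP] k : exists tc : (nat -> A) * I,
      [/\ F k tc.1, forall i, i < m -> tc.1 i = s i & exists2 a : Emb A, Aut A a &
         forall i, i < m.+1 -> tc.1 i = a (r tc.2 i)].
    have [t Ft ts] := Ps k; have [c cP] := rP t; by exists (t, c).
  (* One orbit of prefixes of length [m.+1] occurs for arbitrarily large [k]; automorphisms move its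
     members onto the prefix chosen at [k0]. *)
  have [c cP] := infinitely_repeated_value (fun k => (tc k).2).
  have [k0 _ k0c] := cP 0.
  have [_ k0s [a a_aut aE]] := tcP k0.
  exists (tc k0).1 => // k; have [k' kk' k'c] := cP k.
  have [Fk' _ [a' a'_aut a'E]] := tcP k'.
  have [b b_aut [a'K _]] := Aut_inverse a'_aut.
  exists (a \o (b \o (tc k').1)).
    by do 2![apply: (Faut) => //]; apply: Fle Fk'.
  by move=> i im /=; rewrite a'E // aE // k'c k0c a'K.
by exists s => m; have [t Ft ts] := sP m m; exact: Floc ts Ft.
Qed.

(** Counterexamples agreeing on longer and longer initial segments yield, by compactness, an
    embedding at which [g] would not be locally constant. The second hypothesis makes the set of
    counterexamples invariant under automorphisms. *)
Lemma locally_constant_uniform (B : Type) (g : Emb A -> B) :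
  (forall s : Emb A, exists m, forall t : Emb A,
     (forall i, i < m -> t (e i) = s (e i)) -> g t = g s) ->
  (forall s t a, Aut A a -> g s = g t -> g (emb_mul s a) = g (emb_mul t a)) ->
  exists m, forall s t : Emb A, (forall i, i < m -> s (e i) = t (e i)) -> g s = g t.
Proof.
move=> g_loc g_aut; apply: contrapT => /forallNP nunif.
pose F m : set (nat -> A) := [set u | exists s t : Emb A,
  [/\ forall i, i < m -> s (e i) = t (e i), g s <> g t
    & forall i, i < m -> u i = s (e i)]].
have [||||u uP] := @oligomorphic_compact F.
- move=> m u w uw [s [t [st gst us]]]; exists s, t; split=> // i im.
  by rewrite -uw ?us.
- move=> m u [s [t [st gst us]]]; exists s, t; split=> // i im;
    by [apply: st; apply: leqW|apply: us; apply: leqW].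
- move=> m u a a_aut [s [t [st gst us]]]; exists (emb_mul s a), (emb_mul t a).
  split=> [i im|gsta|i im] /=; [by rewrite st| |by rewrite us].
  have [b b_aut [aK _]] := Aut_inverse a_aut; apply: gst.
  have cancel_ab w : emb_mul (emb_mul w a) b = w.
    by apply: emb_eq; apply/funext => x /=.
  by rewrite -[s]cancel_ab -[t]cancel_ab; apply: g_aut.
- move=> m; have /existsNP [s /existsNP [t /not_implyP [st gst]]] := nunif m.
  by exists (s \o e), s, t.
(* Each finite part of [u] is the image of that part of [e] under an embedding, so [u] has the
   quantifier-free type of [e]. *)
have [h hE] : exists h : Emb A, forall i, h (e i) = u i.
  apply: embedding_of_enumerations => // m phi v qphi.
  have [s [t [_ _ us]]] := uP (\max_i v i).+1.
  rewrite (sat_embedding_qf s) //; suff -> : u \o v = s \o (e \o v) by [].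
  by apply/funext => i; rewrite /= us // ltnS leq_bigmax.
have [m mP] := g_loc h; have [s [t [st gst us]]] := uP m.
by apply: gst; rewrite (mP s) ?(mP t) // => i im; rewrite hE us ?st.
Qed.

(** * Existential definability of relations preserved by self-embeddings *)

Definition same_qf_type m (v w : 'I_m -> A) : Prop :=
  forall phi : formula L m, quantifier_free phi -> sat phi v <-> sat phi w.

Lemma same_qf_type_sym m (v w : 'I_m -> A) : same_qf_type v w -> same_qf_type w v.
Proof. by move=> vw phi qphi; rewrite vw. Qed.

Lemma same_qf_type_trans m (v w u : 'I_m -> A) :
  same_qf_type v w -> same_qf_type w u -> same_qf_type v u.
Proof. by move=> vw wu phi qphi; rewrite vw ?wu. Qed.

Lemma same_qf_type_comp m k (r : 'I_k -> 'I_m) (v w : 'I_m -> A) :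
  same_qf_type v w -> same_qf_type (v \o r) (w \o r).
Proof.
by move=> vw phi qphi; rewrite -(sat_ren phi r v) -(sat_ren phi r w) vw ?ren_qf.
Qed.

Lemma same_qf_type_emb m (h : Emb A) (v : 'I_m -> A) : same_qf_type v (h \o v).
Proof. by move=> phi qphi; apply: sat_embedding_qf. Qed.

(** Orbit representatives exhaust the quantifier-free types. For a representative [k] in [Y],
    [chi k] separates it from all representatives outside [Y]; the disjunction of the [chi k]
    defines [Y]. *)
Lemma qf_definable m (Y : set ('I_m -> A)) :
  (forall v w, same_qf_type v w -> Y v -> Y w) ->
  exists2 phi : formula L m, quantifier_free phi & forall v, Y v <-> sat phi v.
Proof.
move=> Yqf; have [I [r rP]] := A_olig m.
pose rv k := r k \o @nat_of_ord m.
have repr v : exists k, same_qf_type (rv k) v.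
  pose s i := if insub i is Some j then v j else e 0.
  have [k [a _ aE]] := rP s; exists k.
  suff -> : v = a \o rv k by apply: same_qf_type_emb.
  by apply/funext => i /=; rewrite -aE // /s valK.
have /choice [chi chiP] k : exists chi : formula L m, [/\ quantifier_free chi,
    Y (rv k) -> sat chi (rv k) & forall v, sat chi v -> Y v].
  have [Yk|nYk] := pselect (Y (rv k)); last by exists (FFalse L m).
  have /choice [psi psiP] l : exists psi : formula L m, [/\ quantifier_free psi,
      sat psi (rv k) & ~ Y (rv l) -> ~ sat psi (rv l)].
    have [Yl|nYl] := pselect (Y (rv l)); first by exists (FNot (FFalse L m)); split.
    have /existsNP [psi /not_implyP [qpsi ne]] : ~ same_qf_type (rv k) (rv l).
      by move=> /Yqf /(_ Yk).
    have [hk|hk] := pselect (sat psi (rv k)).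
      by exists psi; split=> // _ hl; apply: ne.
    exists (FNot psi); split=> //= _ hl; apply: ne; split=> // h.
  exists (FAll psi); split.
  - by apply: FAll_qf => l; case: (psiP l).
  - by move=> _; apply/sat_FAll => l; case: (psiP l).
  - move=> v /sat_FAll h; have [l lv] := repr v; apply: Yqf (lv) _.
    have [ql _ nl] := psiP l; apply: contrapT => /nl; apply.
    by apply/lv.
exists (FNot (FAll (fun k => FNot (chi k)))).
  by apply: FAll_qf => k /=; case: (chiP k).
move=> v; split=> [Yv /sat_FAll h|h].
  have [k kv] := repr v; have [qk hk _] := chiP k; apply: (h k).
  by apply/kv => //; apply: hk; apply: Yqf Yv; apply: same_qf_type_sym.
apply: contrapT => nYv; apply: h; apply/sat_FAll => k /= kv; apply: nYv.
by have [_ _] := chiP k; apply.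
Qed.

Lemma existentially_definable_proj n m (Y : set ('I_(n + m) -> A)) :
  (forall v w, same_qf_type v w -> Y v -> Y w) ->
  existentially_definable [set v : 'I_n -> A | exists2 w : nat -> A,
    forall j : 'I_n, w j = v j & Y (w \o @nat_of_ord _)].
Proof.
move=> /qf_definable [theta qtheta thetaP].
(* [exs] binds the initial variables, whereas the projected ones come last in [Y]. *)
pose swap (i : 'I_(n + m)) : 'I_(m + n) := match fintype.split i with
  inl j => rshift m j | inr j => lshift n j end.
exists (exs (ren theta swap)).
  by apply/exs_existential/qf_existential; rewrite ren_qf.
apply/seteqP; split=> v /=.
  move=> [w wv /thetaP Yw]; apply/sat_exs.
  pose u (i : 'I_(m + n)) := match fintype.split i with
    inl j => w (n + j) | inr j => w j end.
  exists u; first by apply/funext => j; rewrite /= /u (unsplitK (inr j)) wv.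
  apply/sat_ren; move: Yw; congr (sat theta _); apply/funext => i /=.
  rewrite /u /swap; have [j ->|j ->] := split_ordP i.
    by rewrite (unsplitK (inr j)).
  by rewrite (unsplitK (inl j)).
move=> /sat_exs [u <- /sat_ren hu].
exists (fun i => if insub i is Some i' then u (swap i') else e 0).
  move=> j; rewrite (_ : nat_of_ord j = val (lshift m j)) // valK /swap.
  by rewrite (unsplitK (inl j)).
apply/thetaP; move: hu; congr (sat theta _); apply/funext => i /=.
by rewrite valK.
Qed.

Lemma embedding_orbit n (r : nat -> A) (v : 'I_n -> A) :
  let er i := if i < n then r i else e (i - n) in
  (forall m, exists2 w : nat -> A, forall j : 'I_n, w j = v j &
     same_qf_type (w \o @nat_of_ord (n + m)) (er \o @nat_of_ord (n + m))) ->
  exists h : Emb A, v = h \o r \o @nat_of_ord n.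
Proof.
move=> er vP.
(* Compactness needs sets closed under automorphisms, so [F] asks only for an automorphic copy of
   [v]; the automorphism is undone at the end. *)
pose F m : set (nat -> A) := [set w : nat -> A |
  same_qf_type (w \o @nat_of_ord m) (er \o @nat_of_ord m) /\
  exists2 a : Emb A, Aut A a & forall j : 'I_n, j < m -> w j = a (v j)].
have [||||w wP] := @oligomorphic_compact F.
- move=> m s t st [sF [a a_aut aE]]; split; last first.
    by exists a => // j jm; rewrite -st ?aE.
  suff <- : s \o @nat_of_ord m = t \o @nat_of_ord m by [].
  by apply/funext => i /=; rewrite st.
- move=> m s [sF [a a_aut aE]]; split; last first.
    by exists a => // j jm; rewrite aE // leqW.
  exact: (same_qf_type_comp (widen_ord (leqnSn m)) sF).
- move=> m s a a_aut [sF [b b_aut bE]]; split; last first.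
    by exists (emb_mul b a); [exact: Aut_mul|move=> j jm /=; rewrite bE].
  apply: same_qf_type_trans sF; apply: same_qf_type_sym.
  exact: (same_qf_type_emb a (s \o @nat_of_ord m)).
- move=> m; have [w wv wF] := vP m; exists w; split.
    exact: (same_qf_type_comp (widen_ord (leq_addl n m)) wF).
  by exists (emb_one A); [exact: Aut_one|move=> j _; rewrite wv].
have er_surj x : exists i, er i = x.
  have [i <-] := e_surj x; exists (n + i).
  by rewrite /er ltnNge leq_addr addKn.
have [h hE] : exists h : Emb A, forall i, h (er i) = w i.
  apply: embedding_of_enumerations => // m phi u qphi.
  have [h _] := wP (\max_i u i).+1.
  pose u' i : 'I_(\max_i u i).+1 := inord (u i).
  have uE (s : nat -> A) : s \o u = (s \o @nat_of_ord _) \o u'.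
    by apply/funext => i; rewrite /= inordK // ltnS leq_bigmax.
  by rewrite !uE; apply: (same_qf_type_comp u' (same_qf_type_sym h)).
have [_ [a a_aut aE]] := wP n; have [b _ [aK _]] := Aut_inverse a_aut.
exists (emb_mul h b); apply/funext => j /=.
have := hE j; rewrite /er ltn_ord => ->; by rewrite aE ?aK.
Qed.

(** Whether an embedding maps representative [k] to representative [l] is decided by extensions of
    all finite lengths; for finitely many pairs one length [M] suffices. Then [X] consists of the
    tuples that [M] further elements extend to the quantifier-free type of [er k] for some
    representative [k] in [X]. *)
Lemma emb_invariant_existentially_definable n (X : set ('I_n -> A)) :
  (forall (h : Emb A) v, X v -> X (h \o v)) -> existentially_definable X.
Proof.
move=> Xinv; have [I [r rP]] := A_olig n.
have repr (v : 'I_n -> A) : exists k, exists2 a : Emb A, Aut A a &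
    v = a \o (r k \o @nat_of_ord n).
  pose s i := if insub i is Some j then v j else e 0.
  have [k [a a_aut aE]] := rP s; exists k, a => //.
  by apply/funext => i /=; rewrite -aE // /s valK.
pose er k i := if i < n then r k i else e (i - n).
pose D k m (v : 'I_n -> A) := exists2 w : nat -> A, forall j : 'I_n, w j = v j &
  same_qf_type (w \o @nat_of_ord (n + m)) (er k \o @nat_of_ord (n + m)).
have Dle k m m' v : m <= m' -> D k m' v -> D k m v.
  move=> mm' [w wv h]; exists w => //.
  have le : n + m <= n + m' by rewrite leq_add2l.
  exact: (same_qf_type_comp (widen_ord le) h).
(* [M0] is a length at which the extension fails, or 0 if it never fails. *)
have /choice [M0 M0P] (kl : I * I) : exists m,
    D kl.1 m (r kl.2 \o @nat_of_ord n) ->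
    forall m', D kl.1 m' (r kl.2 \o @nat_of_ord n).
  have [h|/existsNP [m mP]] :=
    pselect (forall m', D kl.1 m' (r kl.2 \o @nat_of_ord n)).
    by exists 0.
  by exists m.
pose M := \max_kl M0 kl.
pose Y : set ('I_(n + M) -> A) := [set u : 'I_(n + M) -> A |
  exists2 k, X (r k \o @nat_of_ord n) &
  same_qf_type u (er k \o @nat_of_ord (n + M))].
have -> : X = [set v : 'I_n -> A | exists2 w : nat -> A,
    forall j : 'I_n, w j = v j & Y (w \o @nat_of_ord _)].
  apply/seteqP; split=> v /=.
    have [k [a a_aut ->]] := repr v => Xv.
    have [b _ [aK _]] := Aut_inverse a_aut.
    exists (a \o er k) => [j|]; first by rewrite /= /er ltn_ord.
    exists k; last by apply/same_qf_type_sym/(same_qf_type_emb a).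
    have := Xinv b _ Xv; congr X; apply/funext => i; exact: aK.
  move=> [w wv [k Xk wk]].
  have [l [a a_aut vl]] := repr v; have [b _ [aK _]] := Aut_inverse a_aut.
  have Dl : D k M (r l \o @nat_of_ord n).
    exists (b \o w) => [j|]; first by rewrite /= wv vl /= aK.
    apply: same_qf_type_trans wk.
    exact/same_qf_type_sym/(same_qf_type_emb b (w \o @nat_of_ord _)).
  have [h hE] : exists h : Emb A, r l \o @nat_of_ord n = h \o r k \o @nat_of_ord n.
    apply: embedding_orbit; apply: (M0P (k, l)).
    apply: Dle Dl; exact: leq_bigmax.
  by rewrite vl hE; do 2!apply: (Xinv).
apply: existentially_definable_proj => u w uw [k Xk uk]; exists k => //.
by apply: same_qf_type_trans uk; apply: same_qf_type_sym.
Qed.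

End Oligomorphic.

(** * Interpretations and continuous actions *)

Lemma nbhs_EmbP (L : signature) (M : structure L) (s : Emb M) (V : set (Emb M)) :
  nbhs s V <-> exists n (a : 'I_n -> M),
    forall t : Emb M, (forall i, t (a i) = s (a i)) -> V t.
Proof.
split=> [[O [[D DS <-] [U DU Us] OV]]|[n [a aP]]].
  have [n [a [b UE]]] := DS U DU; rewrite UE in Us.
  exists n, a => t ta; apply: OV; exists U => //; rewrite UE /= => i.
  by rewrite ta; apply: Us.
pose U := [set t : Emb M | forall i, t (a i) = s (a i)].
exists U; split=> //; exists [set U]; last by rewrite bigcup_set1.
by move=> _ ->; exists n, a, (s \o a).
Qed.

Lemma nbhs_EndoP (L : signature) (M : structure L) (s : Endo M) (V : set (Endo M)) :
  nbhs s V <-> exists n (a : 'I_n -> M),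
    forall t : Endo M, (forall i, t (a i) = s (a i)) -> V t.
Proof.
split=> [[O [[D DS <-] [U DU Us] OV]]|[n [a aP]]].
  have [n [a [b UE]]] := DS U DU; rewrite UE in Us.
  exists n, a => t ta; apply: OV; exists U => //; rewrite UE /= => i.
  by rewrite ta; apply: Us.
pose U := [set t : Endo M | forall i, t (a i) = s (a i)].
exists U; split=> //; exists [set U]; last by rewrite bigcup_set1.
by move=> _ ->; exists n, a, (s \o a).
Qed.

Lemma continuous_pointwiseP (LA LB : signature) (A : structure LA)
    (B : structure LB) (f : Emb A -> Endo B) :
  continuous f <-> forall (s : Emb A) (b : B), exists n (a : 'I_n -> A),
    forall t : Emb A, (forall i, t (a i) = s (a i)) -> f t b = f s b.
Proof.
split=> [f_cont s b|f_pt s V /nbhs_EndoP [n [b bV]]].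
  apply/(nbhs_EmbP s [set t | f t b = f s b]).
  apply: (f_cont s [set u : Endo B | u b = f s b]).
  by apply/nbhs_EndoP; exists 1, (fun=> b) => t /(_ ord0).
have : nbhs s [set t | forall i, f t (b i) = f s (b i)].
  apply: (@filter_forall _ 'I_n (fun (i : 'I_n) t => f t (b i) = f s (b i))
    (nbhs s) _) => i.
  by apply/(nbhs_EmbP s [set t | f t (b i) = f s (b i)]); apply: f_pt.
by apply: filterS => t; apply: bV.
Qed.

Section Interpretations.
Variables (LA LB : signature) (A : structure LA) (B : structure LB).

Lemma basic_set_endo (h : Endo B) k (X : set ('I_k -> B)) (v : 'I_k -> B) :
  basic_set X -> X v -> X (h \o v).
Proof.
move=> bX; move: v; case: k X / bX => [|v /= ->|R v|c v /= ->] //=.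
- exact: (endoP h).1.
- exact: (endoP h).2.
Qed.

(** * From an existential interpretation to a continuous action *)

Section InterpretationToAction.
Variables (n : nat) (U : set ('I_n -> A)) (i : {x | U x} -> B).
Hypothesis i_surj : forall b, exists u, i u = b.
Hypothesis i_def : forall k (X : set ('I_k -> B)), basic_set X ->
  existentially_definable (interp_preimage i X).

Let sval_inj (x y : {x | U x}) : sval x = sval y -> x = y.
Proof. by case: x y => [x px] [y py] /= xy; apply: eq_exist. Qed.

(** Self-embeddings preserve the existential formula defining the preimage of [X], and membership in
    this preimage puts the image tuples back into [U]. *)
Let emb_preimage k (X : set ('I_k -> B)) (h : Emb A) (u : 'I_k -> {x | U x}) :
  basic_set X -> X (i \o u) ->
  exists2 u' : 'I_k -> {x | U x},
    (forall p, sval (u' p) = h \o sval (u p)) & X (i \o u').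
Proof.
move=> bX Xu; have [phi ephi phiE] := i_def bX.
pose w (j : 'I_(k * n)) := mxvec (\matrix_(p < k, q < n) sval (u p) q) ord0 j.
have wE p q : w (mxvec_index p q) = sval (u p) q by rewrite /w mxvecE mxE.
have : interp_preimage i X w by exists u.
rewrite phiE => /(sat_embedding_existential h ephi) hw.
have : interp_preimage i X (h \o w) by rewrite phiE.
move=> [u' u'E Xu']; exists u' => // p; apply/funext => q.
by rewrite -u'E /= wE.
Qed.

Let emb_lift (h : Emb A) : exists g : {x | U x} -> {x | U x},
  forall u, sval (g u) = h \o sval u.
Proof.
have /choice [g gP] (u : {x | U x}) : exists u' : {x | U x}, sval u' = h \o sval u.
  have [u' u'E _] := emb_preimage h (basic_universe B) (u := fun=> u) Logic.I.
  by exists (u' ord0).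
by exists g.
Qed.

Let lift_emb h := projT1 (cid (emb_lift h)).
Let lift_embE h u : sval (lift_emb h u) = h \o sval u.
Proof. exact: (projT2 (cid (emb_lift h))). Qed.

Let lift_basic k (X : set ('I_k -> B)) h (u : 'I_k -> {x | U x}) :
  basic_set X -> X (i \o u) -> X (i \o (lift_emb h \o u)).
Proof.
move=> bX Xu; have [u' u'E] := emb_preimage h bX Xu.
congr (X (i \o _)); apply/funext => p; apply: sval_inj.
by rewrite u'E lift_embE.
Qed.

(** The preimage of the diagonal is the kernel of [i]; its preservation makes the action on [B]
    independent of chosen preimages. *)
Let lift_compat h u u' : i u = i u' -> i (lift_emb h u) = i (lift_emb h u').
Proof.
move=> uu'.
exact: (lift_basic h (u := fun j : 'I_2 => if j == ord0 then u else u')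
  (basic_diagonal B) uu').
Qed.

Let pre b := projT1 (cid (i_surj b)).
Let preE b : i (pre b) = b.
Proof. exact: (projT2 (cid (i_surj b))). Qed.

Let act (h : Emb A) (b : B) : B := i (lift_emb h (pre b)).
Let actE h u : act h (i u) = i (lift_emb h u).
Proof. exact/lift_compat/preE. Qed.

Let act_hom h : is_hom (act h).
Proof.
split=> [R v Rv|c].
  have := lift_basic h (u := pre \o v) (basic_relation B R).
  have -> : i \o (pre \o v) = v by apply/funext => j /=.
  exact.
exact: (lift_basic h (u := fun=> pre (cst_of B c)) (basic_constant B c) (preE _)).
Qed.

Lemma interpretation_action (A_olig : oligomorphic A) (a0 : A) :
  exists f : Emb A -> Endo B,
    [/\ monoid.monoid_morphism f, continuous f & finitely_many_orbits (f @` Aut A)].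
Proof.
exists (fun h => MkEndo (act_hom h)); split.
- split=> [|h1 h2]; apply: endo_eq; apply/funext => b /=.
    rewrite -{2}(preE b) /act; congr i; apply: sval_inj; rewrite lift_embE.
    by apply/funext.
  rewrite -(preE b) !actE; congr i; apply: sval_inj; rewrite !lift_embE.
  by apply/funext.
(* The value at [b] depends only on what [s] does to the coordinates of the chosen preimage of
   [b]. *)
- apply/continuous_pointwiseP => s b; exists n, (sval (pre b)) => t ts /=.
  rewrite /act; congr i; apply: sval_inj; rewrite !lift_embE; exact/funext.
- have [I [r rP]] := A_olig n.
  pose rv k := r k \o @nat_of_ord n.
  exists [set b | exists k (Uk : U (rv k)), b = i (exist _ _ Uk)].
    have [[b0 _]|Bempty] := pselect (exists b0 : B, True); last first.
      by apply: (@sub_finite_set _ _ set0) => // b; case: Bempty; exists b.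
    pose b_ k := if pselect (U (rv k)) is left Uk then i (exist _ _ Uk) else b0.
    apply: (@sub_finite_set _ _ (range b_)); last exact: finite_image.
    move=> b [k [Uk ->]]; exists k => //; rewrite /b_; case: pselect => // Uk'.
    by congr i; apply: sval_inj.
  apply/seteqP; split=> // b _.
  pose x := sval (pre b).
  pose s j := if insub j is Some j' then x j' else a0.
  have [k [a a_aut aE]] := rP s; have [c _ [aK _]] := Aut_inverse a_aut.
  have xE : x = a \o rv k by apply/funext => j; rewrite /= -aE // /s valK.
  (* [U] is closed under self-embeddings, in particular under the inverse of [a]. *)
  have Uk : U (rv k).
    have := svalP (lift_emb c (pre b)); rewrite lift_embE -/x xE.
    by congr U; apply/funext => j /=; rewrite aK.
  exists (i (exist _ _ Uk)); first by exists k, Uk.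
  exists (MkEndo (act_hom a)); first by exists a.
  by rewrite /= actE -[RHS]preE; congr i; apply: sval_inj; rewrite lift_embE -/x xE.
Qed.

End InterpretationToAction.

(** * From a continuous action to an existential interpretation *)

Section ActionToInterpretation.
Variable f : Emb A -> Endo B.
Hypothesis f_morph : monoid.monoid_morphism f.
Hypothesis f_cont : continuous f.
Variable e : nat -> A.
Hypothesis e_surj : forall x, exists i, e i = x.
Hypothesis e01 : e 0 <> e 1.
Hypothesis A_olig : oligomorphic A.

Let f_mul s t b : f (emb_mul s t) b = f t (f s b).
Proof. by have /(congr1 (fun h : Endo B => h b)) := f_morph.2 s t. Qed.

Let f_uniform b : exists m, forall s t : Emb A,
  (forall i, i < m -> s (e i) = t (e i)) -> f s b = f t b.
Proof.
apply: locally_constant_uniform => // [s|s t a _ st]; last by rewrite !f_mul st.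
have [n [a aP]] := (continuous_pointwiseP f).1 f_cont s b.
have /choice [idx idxP] j := e_surj (a j).
exists (\max_j idx j).+1 => t ts; apply: aP => j.
by rewrite -idxP; apply: ts; rewrite ltnS leq_bigmax.
Qed.

Variables (k : nat) (b : 'I_k -> B).
Hypothesis b_orbits : forall y, exists j s, f s (b j) = y.

(** The domain consists of the tuples [s \o u j], sent by [i] to [f s (b j)]. Preimages of basic
    sets are preserved by embeddings because each [f h] is an endomorphism, so they are
    existentially definable. *)
Lemma action_interpretation : existentially_interpretable B A.
Proof.
have /choice [m0 m0P] j := f_uniform (b j).
(* One bound for all [j]; it is positive, so [e 0] is among the recorded elements. *)
pose m := (\max_j m0 j).+2.
have mP j (s t : Emb A) : (forall i, i < m -> s (e i) = t (e i)) -> f s (b j) = f t (b j).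
  move=> st; apply: m0P => i im; apply: st.
  by rewrite /m !leqW // (leq_trans im) // leq_bigmax.
(* The first k coordinates encode j by their equality pattern with e 0. *)
pose u j (l : 'I_(k + m)) := match fintype.split l with
  inl l' => e (l' == j) | inr l' => e l' end.
have u_inj j j' (s t : Emb A) : s \o u j = t \o u j' -> f s (b j) = f t (b j').
  move=> /funeqP st.
  have st_e i : i < m -> s (e i) = t (e i).
    move=> im; have := st (rshift k (Ordinal im)).
    by rewrite /= /u (unsplitK (inr _)).
  (* If [j] and [j'] differ, coordinate [j] yields [s (e 1) = t (e 0) = s (e 0)], against
     injectivity of [s]. *)
  have := st (lshift m j); rewrite /= /u (unsplitK (inl _)) /= eqxx.
  have [-> _|_ e10] := eqVneq j j'; first exact: mP.
  by case: e01; have [s_inj _ _] := embP s; apply: s_inj; rewrite e10 st_e.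
pose U : set ('I_(k + m) -> A) := [set x | exists j (s : Emb A), x = s \o u j].
have /choice [i iP] (x : {x | U x}) : exists y, forall j (s : Emb A),
    sval x = s \o u j -> y = f s (b j).
  case: x => x [j [s xE]]; exists (f s (b j)) => j' s' /= xE'.
  by apply: u_inj; rewrite -xE.
have Uu j (s : Emb A) : U (s \o u j) by exists j, s.
exists (k + m), U, i; split=> [y|q X bX].
  have [j [s <-]] := b_orbits y; exists (exist _ _ (Uu j s)).
  exact: iP.
apply: (emb_invariant_existentially_definable A_olig e_surj) => h w [v vw Xv].
have /choice [v' v'P] (p : 'I_q) : exists x' : {x | U x},
    sval x' = h \o sval (v p) /\ i x' = f h (i (v p)).
  have [j [s vE]] := svalP (v p).
  exists (exist _ _ (Uu j (emb_mul s h))); split; first by rewrite /= vE.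
  by rewrite (iP _ j (emb_mul s h)) // (iP _ j s) // f_mul.
exists v' => [p l|]; first by rewrite (v'P p).1 /= vw.
suff -> : i \o v' = f h \o (i \o v) by apply: basic_set_endo.
by apply/funext => p; case: (v'P p).
Qed.

End ActionToInterpretation.
End Interpretations.

Theorem theorem7 (LA LB : signature) (A : structure LA) (B : structure LB)
    (A_cat : aleph0_categorical A) (A_ge2 : exists x y : A, x <> y) :
  [<-> existentially_interpretable B A;
       exists f : Emb A -> Endo B,
         [/\ monoid.monoid_morphism f, continuous f
           & finitely_many_orbits (range f)];
       exists f : Emb A -> Endo B,
         [/\ monoid.monoid_morphism f, continuous f
           & finitely_many_orbits (f @` Aut A)]].
Proof.
have [x [y xy]] := A_ge2.
have A_olig := aleph0_categorical_oligomorphic x A_cat.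
have [e0 e0_surj] := countable_surj x (aleph0_categorical_countable A_cat).
(* The enumeration begins with two distinct elements, which serve to encode the indices of orbit
   representatives. *)
pose e i := match i with 0 => x | 1 => y | j.+2 => e0 j end.
have e_surj z : exists i, e i = z by have [j <-] := e0_surj z; exists j.+2.
have P13 : existentially_interpretable B A -> exists f : Emb A -> Endo B,
    [/\ monoid.monoid_morphism f, continuous f & finitely_many_orbits (f @` Aut A)].
  by move=> [n [U [i [i_surj i_def]]]]; apply: (interpretation_action i_surj i_def).
have P32 : (exists f : Emb A -> Endo B,
      [/\ monoid.monoid_morphism f, continuous f & finitely_many_orbits (f @` Aut A)]) ->
    exists f : Emb A -> Endo B,
      [/\ monoid.monoid_morphism f, continuous f & finitely_many_orbits (range f)].
  move=> [f [f_morph f_cont [D Dfin DE]]]; exists f; split=> //; exists D => //.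
  apply/seteqP; split=> // z _.
  have [b Db [_ [s _ <-] <-]] :
      (\bigcup_(b in D) orbit_of (f @` Aut A) b) z by rewrite DE.
  by exists b => //; exists (f s).
have P21 : (exists f : Emb A -> Endo B,
      [/\ monoid.monoid_morphism f, continuous f & finitely_many_orbits (range f)]) ->
    existentially_interpretable B A.
  move=> [f [f_morph f_cont [D /finite_set_range [k [b bE]] DE]]].
  apply: (action_interpretation f_morph f_cont e_surj xy A_olig (b := b)) => z.
  have [b' + [_ [s _ <-] <-]] : (\bigcup_(b in D) orbit_of (range f) b) z by rewrite DE.
  by rewrite bE => -[j _ <-]; exists j, s.
by tfae; [move/P13/P32|move/P21/P13|move/P32/P21].
Qed.
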